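(* Let $K/k$ be a separable field extension of degree $6$ and let $\widetilde{K}/k$ be its Galois closure. Assume that $\operatorname{Gal}(\widetilde{K}/k)=2S_4$. (a) If $F$ is a field with $K\subset F\subset\widetilde{K}$ and $[F:k]=12$, then $F/k$ is not Hopf Galois. (b) There exists a field $F$ with $K\subset F\subset\widetilde{K}$ such that $[F:k]=24$ and $F/k$ is an almost classically Galois extension. More precisely, let $C$ be the normal subgroup of order $2$ of $G'=\operatorname{Gal}(\widetilde{K}/K)$. Then, for any field $F$ with $K\subset F\subset\widetilde{K}$, $[F:k]=24$ and $F\neq\widetilde{K}^{C}$, the extension $F/k$ is almost classically Galois and has at least two different Hopf Galois structures.
   Context: $2S_4$ denotes the transitive permutation group $6T11$ of degree $6$ and order $48$; abstractly it is isomorphic to $S_4\times C_2$, and its point stabilizers are dihedral of order $8$ (so $G'$ is dihedral of order $8$ and has a unique normal subgroup of order $2$). The Galois group $G=\operatorname{Gal}(\widetilde{K}/k)$ is viewed as a transitive permutation group of degree $6$ via left translation on $G/\operatorname{Gal}(\widetilde{K}/K)$. A finite extension of fields $L/k$ is called Hopf Galois if there exists a finite cocommutative $k$-Hopf algebra $H$ such that $L$ is an $H$-module algebra and the $k$-linear map $j: L\otimes_k H\to \operatorname{End}_k(L)$, $j(s\otimes h)(t)=s(ht)$ for $h\in H$, $s,t\in L$, is bijective. A Hopf Galois structure on $L/k$ is such an $H$ together with its action on $L$, considered up to isomorphism of $k$-Hopf algebras compatible with the actions on $L$. Let $L/k$ be a finite separable extension with Galois closure $\widetilde{L}/k$, $\Gamma=\operatorname{Gal}(\widetilde{L}/k)$,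 $\Gamma'=\operatorname{Gal}(\widetilde{L}/L)$, and let $\lambda:\Gamma\to\operatorname{Sym}(\Gamma/\Gamma')$ be the left translation action on left cosets. $L/k$ is called almost classically Galois if there is a regular (i.e. sharply transitive) subgroup $N$ of $\operatorname{Sym}(\Gamma/\Gamma')$ which is normalized by $\lambda(\Gamma)$ and contained in $\lambda(\Gamma)$; equivalently, $\Gamma'$ has a normal complement in $\Gamma$. *)

(* Defs.v *)
From HB Require Import structures.
From mathcomp Require Import all_boot all_order all_algebra all_fingroup.
From mathcomp Require Import all_solvable all_field.

Set Implicit Arguments.
Unset Strict Implicit.
Unset Printing Implicit Defensive.

Import GroupScope GRing.Theory.
Local Open Scope ring_scope.

(** * Tensor products of finite-dimensional vector spaces *)

(* V ⊗ W is modelled by its coordinate matrices in the bases chosen by the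
   library: t stands for \sum_(i, j) t i j *: (b_i ⊗ c_j).  The lemmas
   tens_lift_linear, tens_liftE and tens_lift_unique are the universal
   property. *)
Definition tensor (k : fieldType) (V W : vectType k) :=
  'M[k]_(\dim {:V}, \dim {:W}).

Definition tens (k : fieldType) (V W : vectType k) (v : V) (w : W) :
    tensor V W :=
  \matrix_(i, j) (coord (vbasis {:V}) i v * coord (vbasis {:W}) j w).

(* The linear map V ⊗ W -> U induced by b; only meaningful for bilinear b. *)
Definition tens_lift (k : fieldType) (V W U : vectType k) (b : V -> W -> U)
    (t : tensor V W) : U :=
  \sum_i \sum_j t i j *: b (vbasis {:V})`_i (vbasis {:W})`_j.

Section TensorTheory.
Variables (k : fieldType) (V W U : vectType k).

Lemma tens_lift_linear (b : V -> W -> U) : linear (tens_lift b).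
Proof.
move=> a s t; rewrite /tens_lift scaler_sumr -big_split; apply: eq_bigr => i _.
rewrite scaler_sumr -big_split; apply: eq_bigr => j _.
by rewrite !mxE scalerDl scalerA.
Qed.

Lemma tens_liftE (b : V -> W -> U) :
    (forall w, linear (b^~ w)) -> (forall v, linear (b v)) ->
  forall v w, tens_lift b (tens v w) = b v w.
Proof.
move=> linl linr v w.
pose bl w' := GRing.isLinear.Build k V U *:%R (b^~ w') (linl w').
pose Bl w' : {linear V -> U} := HB.pack (b^~ w') (bl w').
pose br v' := GRing.isLinear.Build k W U *:%R (b v') (linr v').
pose Br v' : {linear W -> U} := HB.pack (b v') (br v').
rewrite -[b v w]/(Bl w v) [in RHS](coord_vbasis (memvf v)) linear_sum.
apply: eq_bigr => i _; rewrite linearZ -[Bl w _]/(Br (vbasis {:V})`_i w).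
rewrite [in RHS](coord_vbasis (memvf w)) linear_sum [RHS]scaler_sumr.
by apply: eq_bigr => j _; rewrite linearZ mxE [RHS]scalerA.
Qed.

Lemma tens_lift_unique (f : {linear tensor V W -> U}) (t : tensor V W) :
  f t = tens_lift (fun v w => f (tens v w)) t.
Proof.
have tensb (i : 'I_(\dim {:V})) (j : 'I_(\dim {:W})) :
    tens (vbasis {:V})`_i (vbasis {:W})`_j = delta_mx i j.
  apply/matrixP=> i' j'; rewrite !mxE !coord_free ?(basis_free (vbasisP _)) //.
  by rewrite -natrM mulnb [i == _]eq_sym [j == _]eq_sym.
rewrite {1}[t]matrix_sum_delta linear_sum; apply: eq_bigr => i _.
by rewrite linear_sum; apply: eq_bigr => j _; rewrite linearZ tensb.
Qed.

End TensorTheory.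

Definition tens_map (k : fieldType) (V W V' W' : vectType k)
    (f : V -> V') (g : W -> W') : tensor V W -> tensor V' W' :=
  tens_lift (fun v w => tens (f v) (g w)).

Definition tens_swap (k : fieldType) (V W : vectType k) :
    tensor V W -> tensor W V :=
  tens_lift (fun v w => tens w v).

Definition tens_assoc (k : fieldType) (U V W : vectType k) :
    tensor (tensor U V) W -> tensor U (tensor V W) :=
  tens_lift (fun uv w => tens_lift (fun u v => tens u (tens v w)) uv).

Definition tens_mul (k : fieldType) (A B : falgType k) (s t : tensor A B) :
    tensor A B :=
  tens_lift (fun a b => tens_lift (fun a' b' => tens (a * a') (b * b')) t) s.

(** * Hopf algebras and Hopf Galois structures *)

(* The unit and inverse operations of a falgType are determined by its
   multiplication, so H : falgType k is exactly a nonzero finite-dimensional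
   unital associative k-algebra. *)
Record hopf_algebra (k : fieldType) := HopfAlgebra {
  hopf_sort :> falgType k;
  comul : {linear hopf_sort -> tensor hopf_sort hopf_sort};
  counit : {linear hopf_sort -> k^o};
  antipode : {linear hopf_sort -> hopf_sort};
  comul1 : comul 1 = tens 1 1;
  comulM : forall x y, comul (x * y) = tens_mul (comul x) (comul y);
  counit1 : counit 1 = 1;
  counitM : forall x y, counit (x * y) = counit x * counit y;
  comulA : forall x,
    tens_assoc (tens_map comul idfun (comul x)) =
    tens_map idfun comul (comul x);
  counitl : forall x, tens_lift (fun a b => counit a *: b) (comul x) = x;
  counitr : forall x, tens_lift (fun a b => counit b *: a) (comul x) = x;
  antipodel : forall x,
    tens_lift (fun a b => antipode a * b) (comul x) = (counit x : k)%:A;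
  antipoder : forall x,
    tens_lift (fun a b => a * antipode b) (comul x) = (counit x : k)%:A
}.

Arguments comul {k h}.
Arguments counit {k h}.
Arguments antipode {k h}.

Definition cocommutative (k : fieldType) (H : hopf_algebra k) : Prop :=
  forall x : H, tens_swap (comul x) = comul x.

(* The map j : L ⊗ H -> End_k(L), j (s ⊗ h) t = s * (h t). *)
Definition hopf_galois_map (k : fieldType) (L : fieldExtType k)
    (H : hopf_algebra k) (act : H -> 'End(L)) : tensor L H -> 'End(L) :=
  tens_lift (fun (s : L) (h : H) => (amull s \o act h)%VF).

Record hopf_galois_structure (k : fieldType) (L : fieldExtType k) :=
  HopfGaloisStructure {
  hgs_alg :> hopf_algebra k;
  hgs_act : {linear hgs_alg -> 'End(L)};
  hgs_cocomm : cocommutative hgs_alg;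
  hgs_act1 : forall t, hgs_act 1 t = t;
  hgs_actM : forall g h t, hgs_act (g * h) t = hgs_act g (hgs_act h t);
  hgs_act_one : forall h, hgs_act h 1 = (counit h : k)%:A;
  hgs_act_mul : forall h s t,
    hgs_act h (s * t) =
    tens_lift (fun a b => hgs_act a s * hgs_act b t) (comul h);
  hgs_bij : bijective (hopf_galois_map hgs_act)
}.

Definition hopf_galois (k : fieldType) (L : fieldExtType k) : Prop :=
  inhabited (hopf_galois_structure L).

Definition hgs_isomorphic (k : fieldType) (L : fieldExtType k)
    (S1 S2 : hopf_galois_structure L) : Prop :=
  exists f : {linear S1 -> S2},
    [/\ bijective f,
        f 1 = 1 /\ (forall x y, f (x * y) = f x * f y),
        (forall x, comul (f x) = tens_map f f (comul x)) /\
          (forall x, counit (f x) = counit x),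
        forall x, antipode (f x) = f (antipode x)
      & forall x t, hgs_act S2 (f x) t = hgs_act S1 x t].

(** * Permutations of coset spaces *)

(* The product of {perm _} and of gal_of is "left factor first", so the left
   cosets x∘H and left translation by g of the usual convention for functions
   are here the right cosets H :* x and right multiplication by g. *)
Definition coset_translation (gT : finGroupType) (G H : {group gT}) (g : gT) :
    {perm {set gT}} :=
  restr_perm (rcosets H G) (actperm 'Rs g).

Lemma coset_translationE (gT : finGroupType) (G H : {group gT}) (g : gT)
    (X : {set gT}) :
  g \in G -> X \in rcosets H G -> coset_translation G H g X = X :* g.
Proof.
move=> Gg GX; have homR Z z :
    z \in G -> Z \in rcosets H G -> Z :* z \in rcosets H G.
  move=> Gz /rcosetsP[x Gx ->]; rewrite -rcosetM.
  by apply/rcosetsP; exists (x * z)%g; rewrite ?groupM.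
suff nXg : actperm 'Rs g \in 'N(rcosets H G | 'P).
  by rewrite /coset_translation restr_permE // actpermE /= rcosetE.
apply/astabsP => Y; rewrite /= /aperm actpermE /= rcosetE.
apply/idP/idP => [/(homR _ g^-1%g)|]; last exact: homR.
by rewrite groupV -rcosetM mulgV mulg1; apply.
Qed.

(* λ(G) as a subgroup of Sym(G/H). *)
Definition coset_perms (gT : finGroupType) (G H : {group gT}) :
    {set {perm {set gT}}} :=
  [set coset_translation G H g | g in G].

Definition sharply_transitive (T : finType) (N : {set {perm T}}) (X : {set T})
    : Prop :=
  {in X &, forall x y, exists! s, s \in N /\ s x = y}.

(* A permutation group A of the subset X of T (fixing all points outside X) is
   isomorphic, as a permutation group, to the permutation group B of T'. *)
Definition perm_isomorphic (T T' : finType) (X : {set T}) (A : {set {perm T}})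
    (B : {set {perm T'}}) : Prop :=
  exists f : T' -> T,
    [/\ injective f, f @: [set: T'] = X
      & forall p : {perm T'},
          p \in B <-> exists2 s, s \in A & forall i, f (p i) = s (f i)].

Definition transp6 (i j : nat) : {perm 'I_6} := tperm (inord i) (inord j).

(* The transitive group 6T11 = 2S_4(6) = 2 wr S_3, given by the generators
   (3,6), (1,3,5)(2,4,6), (1,5)(2,4) of the standard list of transitive
   groups; the point i of {1, ..., 6} is the ordinal i - 1. *)
Definition group6T11 : {group {perm 'I_6}} :=
  <<[set transp6 2 5;
         transp6 0 2 * transp6 0 4 * (transp6 1 3 * transp6 1 5);
         transp6 0 4 * transp6 1 3]%g>>%G.

(** * Galois closures and almost classically Galois extensions *)

Section GaloisClosure.
Variables (k : fieldType) (L : splittingFieldType k).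

(* As L/k is normal, the Galois closure of a separable F/k can be formed
   inside L. *)
Definition is_galois_closure (F E : {subfield L}) : Prop :=
  [/\ (F <= E)%VS, galois 1 E
    & forall M : {subfield L}, (F <= M)%VS -> galois 1 M -> (E <= M)%VS].

Definition almost_classically_galois (F : {subfield L}) : Prop :=
  separable 1 F /\
  exists2 E : {subfield L}, is_galois_closure F E &
    let G := 'Gal(E / 1)%G in
    let G' := 'Gal(E / F)%G in
    exists N : {group {perm {set gal_of E}}},
      [/\ N \subset perm.Sym (rcosets G' G),
          sharply_transitive N (rcosets G' G),
          coset_perms G G' \subset 'N(N)
        & N \subset coset_perms G G'].

End GaloisClosure.

(* Main.v *)
Require Import Defs.
From HB Require Import structures.
From mathcomp Require Import all_boot all_order all_algebra all_fingroup.
From mathcomp Require Import all_solvable all_field.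

(* Both halves go through the Greither-Pareigis correspondence, of which only
   two explicit special cases are needed.

   From a Hopf Galois structure H on F/k one gets a regular group of
   permutations of the k-embeddings F -> E into the Galois closure: with
   h_1, ..., h_d a basis of H, bijectivity of j says that the matrix
   (h_i t_l) is invertible over F, so for two embeddings x, y there is a unique
   e in E (x) H with y = \sum_i e_i x(h_i _); such an e is grouplike, and hence
   carries every embedding to an embedding.  The regular group so obtained is
   normalized by the Galois group.  If [F : k] = 12 it has order 12, and a Klein
   four-group of G, the involution z that is central in G and the rotation t of
   that four-group contradict each other: either the Sylow 3-subgroup is normal,
   and then it is centralized by a commutator that centralizes only four
   elements, or the group is of type A_4, and then z lies in a product of two
   Klein four-groups on which t acts without fixed points.

   Conversely, if the Galois group is N ><| Gal(E/F), the fixed points H of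
   E[N] under a semilinear action of the Galois group form a Hopf algebra of
   dimension |N|: by Galois descent a k-basis of H is an E-basis of E[N], so an
   identity in H (x) H can be checked on the coefficients in E[N x N].  The
   conjugation action and its restriction to Gal(E/F) give two Hopf Galois
   structures; they differ because an element c of N that commutes with
   Gal(E/F) but is not central acts through the second one only. *)

Set Implicit Arguments.
Unset Strict Implicit.
Unset Printing Implicit Defensive.

Import GroupScope GRing.Theory.

(** * Regular subgroups of permutation groups *)

Section RotatedInvolution.
Local Open Scope group_scope.
Variables (gT : finGroupType) (a t : gT).
Local Notation b := (a ^ t).
Hypotheses (a1 : a != 1) (a2 : a ^+ 2 = 1) (cab : commute a b).
Hypothesis bt : b ^ t = a * b.

Let order_a : #[a] = 2.
Proof. by apply: nt_prime_order. Qed.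

Let tiab : <[a]> :&: <[b]> = 1.
Proof.
apply: prime_TIg; first by rewrite -orderE order_a.
rewrite cycle_subG /= cycle2g ?orderJ // !inE (negPf a1) /=.
apply/eqP=> ab; case/eqP: a1; apply: (mulgI a).
by rewrite mulg1 {2}ab -bt -ab.
Qed.

Definition klein_group := <[a]> <*> <[b]>.

Lemma klein_groupE : klein_group = <[a]> * <[b]>.
Proof.
apply: cent_joinEr; rewrite cent_cycle cycle_subG; apply/cent1P.
exact: commute_sym.
Qed.

Lemma card_klein_group : #|klein_group| = 4.
Proof.
by rewrite klein_groupE TI_cardMg // -!orderE orderJ order_a.
Qed.

(** Conjugation by [t] permutes the three involutions cyclically, [a] to [b] to [a * b] to [a]. *)
Lemma klein_group_fix x : x \in klein_group -> x ^ t = x -> x = 1.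
Proof.
have b2 : b * b = 1 by rewrite -[b * b]/(b ^+ 2) -conjXg a2 conj1g.
rewrite klein_groupE (cycle2g order_a) (cycle2g (etrans (orderJ a t) order_a)).
case/mulsgP=> y w /set2P[]-> /set2P[]-> ->; rewrite ?mul1g ?mulg1 //.
- by rewrite bt => /(canRL (mulgK b)); rewrite mulgV => /eqP; rewrite (negPf a1).
- by move=> ab; case/eqP: a1; apply: (mulgI a); rewrite mulg1 -{2}ab -bt ab.
rewrite conjMg bt cab mulgA b2 mul1g => /(congr1 (mulg^~ a^-1)).
by rewrite mulgK mulgV => b1; case/eqP: a1; apply: (conjg_inj t); rewrite conj1g.
Qed.

End RotatedInvolution.

(** * Groups of order 12 normalized by a half turn, a rotation and an inversion *)

Section NoRegularSubgroup.
Local Open Scope group_scope.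
Variables (gT : finGroupType) (N : {group gT}) (c t z : gT).
Hypothesis cardN : #|N| = 12%N.
Hypothesis card_cent : (#|'C(N)| %| 12)%N.
Hypotheses (nNc : c \in 'N(N)) (nNt : t \in 'N(N)) (nNz : z \in 'N(N)).
Hypotheses (notNc : c \notin N) (card_centc : #|'C_N[c]| = 4%N).
Hypotheses (c2 : c ^+ 2 = 1) (ccd : commute c (c ^ t)).
Hypothesis dt : (c ^ t) ^ t = c * c ^ t.
Hypotheses (z1 : z != 1) (z2 : z ^+ 2 = 1).
Hypotheses (czc : commute z c) (czt : commute z t).

Let card_centJ : #|'C_N[c ^ t]| = 4%N.
Proof.
have -> : 'C_N[c ^ t] = 'C_N[c] :^ t.
  by rewrite conjIg (normP nNt) -normJ conjg_set1.
by rewrite cardJg.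
Qed.

Let card_centJJ : #|'C_N[(c ^ t) ^ t]| = 4%N.
Proof.
have -> : 'C_N[(c ^ t) ^ t] = 'C_N[c ^ t] :^ t.
  by rewrite conjIg (normP nNt) -normJ conjg_set1.
by rewrite cardJg.
Qed.

(** A normal [Q] is characteristic, so [c] and [t] act on it through the abelian group Aut(Q). Hence
    [[~ c, t] = c * c ^ t] centralizes [Q]; but this is [(c ^ t) ^ t], whose centralizer in [N] has
    order 4. *)
Let sylow3_not_normal (Q : {group gT}) : 3.-Sylow(N) Q -> ~~ (Q <| N).
Proof.
move=> sylQ; apply/negP=> nsQN.
have chQ : Q \char N by rewrite -(normal_Hall_pcore sylQ nsQN) pcore_char.
have [nQc nQt] : c \in 'N(Q) /\ t \in 'N(Q).
  by split; apply: (subsetP (char_norms chQ)).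
have cardQ : #|Q| = 3 by rewrite (card_Hall sylQ) cardN p_part.
have eq_ct : [~ c, t] = (c ^ t) ^ t.
  by rewrite dt commgEl; congr (_ * _); apply: (mulgI c); rewrite mulgV -c2.
have : [~ c, t] \in 'C(Q).
  rewrite -ker_conj_aut; apply/kerP; rewrite ?groupR // morphR //.
  apply/eqP/commgP; apply: (centsP (@Aut_cyclic_abelian _ Q _)).
  - by rewrite prime_cyclic // cardQ.
  - exact: (subsetP (Aut_conj_aut Q 'N(Q)) _ (mem_morphim _ nQc nQc)).
  - exact: (subsetP (Aut_conj_aut Q 'N(Q)) _ (mem_morphim _ nQt nQt)).
rewrite eq_ct => cQe; have /cardSg : Q \subset 'C_N[(c ^ t) ^ t].
  by rewrite subsetI (pHall_sub sylQ) sub_cent1.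
by rewrite cardQ card_centJJ.
Qed.

(** The number of Sylow 3-subgroups divides 12 and is 1 mod 3, so it is 1 or 4. Normality excludes
    1, and 4 leaves a normalizer of order 3. *)
Let sylow3_self_normal (Q : {group gT}) : 3.-Sylow(N) Q -> 'N_N(Q) = Q.
Proof.
move=> sylQ; have sQN := pHall_sub sylQ.
have cardQ : #|Q| = 3 by rewrite (card_Hall sylQ) cardN p_part.
have sQNQ : Q \subset 'N_N(Q) by rewrite subsetI sQN normG.
apply/eqP; rewrite eq_sym eqEcard sQNQ /= cardQ.
have := card_Syl_mod N (isT : prime 3); rewrite (card_Syl sylQ).
have := Lagrange (subsetIl N 'N(Q)); rewrite cardN.
have : #|'N_N(Q)| != 12.
  apply: contra (sylow3_not_normal sylQ) => /eqP card12.
  apply/andP; split=> //; apply/setIidPl/eqP.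
  by rewrite eqEcard subsetIl cardN card12.
move: #|'N_N(Q)| #|_ : _| => m j m12 mj j3.
have: j \in divisors 12 by rewrite -dvdn_divisors // -mj dvdn_mull.
rewrite !inE => Dj; move: mj m12 j3.
case/or4P: Dj => [|||/or3P[]] /eqP-> //; first by rewrite muln1 => ->.
by case: m => [|[|[|[|m]]]].
Qed.

(* The elements of order 3 fill all but four elements of N. *)
Let order4_unique (Q A : {group gT}) : 3.-Sylow(N) Q -> A \subset N ->
  #|A| = 4 -> A :=: N :\: class_support Q^# N.
Proof.
move=> sylQ sAN cardA; have sQN := pHall_sub sylQ.
have cardQ : #|Q| = 3 by rewrite (card_Hall sylQ) cardN p_part.
(* Two conjugates of [Q] that share some [x != 1] are both [<[x]>]. *)
have TIQ : normedTI Q^# N Q.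
  apply/normedTI_P; split.
  - by rewrite setD_eq0 subG1 -cardG_gt1 cardQ.
  - by rewrite subsetI sQN normD1 normG.
  move=> g Ng /pred0Pn[x /andP[/setD1P[x1 Qx]]].
  rewrite conjD1g => /setD1P[_ Qgx].
  rewrite -(sylow3_self_normal sylQ) inE Ng; apply/normP.
  have genx (R : {group gT}) : #|R| = 3 -> x \in R -> <[x]> = R.
    move=> cardR Rx; apply/eqP; rewrite eqEcard cycle_subG Rx cardR.
    have := order_dvdG Rx; rewrite cardR.
    case/primeP: (isT : prime 3) => _ pr3 /pr3.
    by rewrite order_eq1 (negPf x1) -orderE /= => /eqP->.
  by rewrite -[RHS](genx _ cardQ Qx) (genx (Q :^ g)%G) ?cardJg.
have card_supp : #|class_support Q^# N| = 8.
  rewrite (card_support_normedTI TIQ) -(divgS sQN) cardQ cardN.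
  suff -> : #|Q^#| = 2 by [].
  by apply: succn_inj; rewrite -cardQ (cardsD1 1 Q) group1.
apply/eqP; rewrite eqEcard; apply/andP; split.
  apply/subsetP=> x Ax; rewrite inE (subsetP sAN) // andbT.
  apply/imset2P=> [[w g /setD1P[w1 Qw] Ng Dx]].
  have := order_dvdG Ax; rewrite cardA Dx orderJ.
  have := order_dvdG Qw; rewrite cardQ.
  case/primeP: (isT : prime 3) => _ pr3 /pr3.
  by rewrite order_eq1 (negPf w1) => /eqP->.
rewrite cardsD (setIidPr _) ?cardN ?card_supp ?cardA //.
by rewrite class_support_subG // (subset_trans (subD1set _ _)).
Qed.

(** By [order4_unique] all subgroups of order 4 are the same set, and the centralizer of [c] is one
    of them. It follows that this centralizer is invariant under all of ['N(N)]. *)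
Let cent_order4 (A : {group gT}) : A \subset N -> #|A| = 4 -> A :=: 'C_N[c].
Proof.
move=> sAN cardA; have [Q sylQ] := Sylow_exists 3 N.
have := order4_unique (A := 'C_N[c]%G) sylQ (subsetIl _ _) card_centc.
by rewrite /= -(order4_unique sylQ sAN cardA).
Qed.

Local Notation P := 'C_N[c].

Let conjP g : g \in 'N(N) -> P :^ g = P.
Proof.
move=> nNg; apply: (cent_order4 (A := (P :^ g)%G)); rewrite ?cardJg //.
by rewrite -(normP nNg) conjSg subsetIl.
Qed.

Let Pc : c \in 'C(P). Proof. by rewrite -sub_cent1 subsetIr. Qed.

Let Pd : c ^ t \in 'C(P).
Proof.
rewrite -sub_cent1 -(cent_order4 (A := 'C_N[c ^ t]%G)) ?subsetIl ?subsetIr //.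
Qed.

Let abelP : abelian P.
Proof. exact: (@card_p2group_abelian _ 2). Qed.

(** Here [y] generates a Sylow 3-subgroup [Q]. An [x] in [P] commuting with [y] normalizes [Q], so
    lies in the intersection of [Q] and [P], which is trivial; and [N] is the product of [P] and
    [Q]. *)
Let generator3 : exists y, [/\ y \in N, forall x, x \in P -> commute x y -> x = 1
  & forall g, g \in 'C(P) -> commute g y -> g \in 'C(N)].
Proof.
have [Q sylQ] := Sylow_exists 3 N; have sQN := pHall_sub sylQ.
have cardQ : #|Q| = 3 by rewrite (card_Hall sylQ) cardN p_part.
have /cyclicP[y defQ] : cyclic Q by rewrite prime_cyclic // cardQ.
have coPQ : coprime #|P| #|Q| by rewrite card_centc cardQ.
have tiPQ := coprime_TIg coPQ.
exists y; split=> [|x Px cxy | g cPg cgy].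
- by rewrite (subsetP sQN) // defQ cycle_id.
- apply/set1P; rewrite -[[set 1]]/(1 : {set gT}) -tiPQ inE Px.
  rewrite -(sylow3_self_normal sylQ) inE (subsetP (subsetIl _ _) x Px).
  rewrite (subsetP (cent_sub Q)) // defQ cent_cycle; exact/cent1P.
have <- : P * Q = N.
  apply/eqP; rewrite eqEcard mul_subG ?subsetIl //= TI_cardMg //.
  by rewrite card_centc cardQ cardN.
rewrite -[P * Q]/(P * Q) (centM P Q) inE cPg defQ cent_cycle; exact/cent1P.
Qed.

(** The order is a multiple of 4 dividing 12. It is not 12, since [y] would then centralize [P]. *)
Let cent_P : 'C_N(P) = P.
Proof.
have [y [Ny cPy _]] := generator3.
have sPC : P \subset 'C_N(P) by rewrite subsetI subsetIl.
apply/eqP; rewrite eq_sym eqEcard sPC card_centc.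
have := cardSg sPC; have := cardSg (subsetIl N 'C(P)); rewrite card_centc cardN.
have: #|'C_N(P)| != 12.
  apply: contraPneq card_centc => card12; rewrite (_ : P = 1) ?cards1 //.
  have defN : 'C_N(P) = N by apply/eqP; rewrite eqEcard subsetIl cardN card12.
  apply/trivgP/subsetP=> x Px; rewrite inE (cPy x Px) //.
  by have := Ny; rewrite -defN => /setIP[_ /centP/(_ x Px)].
move: #|'C_N(P)| => n n12; rewrite dvdn_divisors // !inE (negPf n12) orbF.
by case/or4P => [|||/orP[]] /eqP->.
Qed.

(* By counting, q |-> [~ y, q] is onto P, so g acts on y like some q in P. *)
Let factor g : g \in 'N(N) -> g \in 'C(P) ->
  exists2 q, q \in P & q^-1 * g \in 'C(N).
Proof.
move=> nNg cPg; have [y [Ny cPy cNE]] := generator3.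
have nPy : y \in 'N(P) by apply/normP/conjP/(subsetP (normG N)).
have nPCy : y \in 'N('C(P)) by rewrite (subsetP (cent_norm _)).
have commP q : q \in P -> [~ y, q] \in P.
  by move=> Pq; rewrite commgEr groupM // memJ_norm // groupV.
have injP : {in P &, injective (fun q => [~ y, q])}.
  move=> q r Pq Pr /= /mulgI yqr; apply/eqP; rewrite eq_mulgV1; apply/eqP.
  apply: cPy; first by rewrite groupM ?groupV.
  apply/commute_sym/commgP/conjg_fixP.
  by rewrite conjgM yqr conjgK.
have imP : [set [~ y, q] | q in P] = P.
  apply/eqP; rewrite eqEcard card_in_imset // leqnn andbT.
  by apply/subsetP=> _ /imsetP[q Pq ->]; apply: commP.
have: [~ y, g] \in [set [~ y, q] | q in P].
  rewrite imP -cent_P inE; apply/andP; split.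
    by rewrite commgEl groupM ?groupV // memJ_norm.
  by rewrite commgEr groupM // memJ_norm // groupV.
case/imsetP=> q Pq /mulgI ygq; exists q => //.
have cPq : q^-1 \in 'C(P) by rewrite groupV (subsetP abelP).
have cgq : commute g q^-1 by apply: (centP cPg); rewrite groupV.
rewrite -cgq.
apply: cNE; first exact: groupM.
by apply/commute_sym/commgP/conjg_fixP; rewrite conjgM ygq conjgK.
Qed.

(** By [factor], [c = q * w] with [q] in [P] and [w] in ['C(N)]. Both factors inherit the relations
    of [c] with [t] and [z], and each spans a four-group rotated by [t]; that of [q] is [P]. So [z]
    centralizes [P] and factors as [r * v]; since [t] fixes [z] it fixes [r], whence [r = 1] and [z]
    lies in ['C(N)]. Together with the four-group of [w] it generates a subgroup of ['C(N)] of order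
    8, which does not divide 12. *)
Lemma no_regular_subgroup : False.
Proof.
have [y [Ny cPy cNE]] := generator3.
have tiPC x : x \in P -> x \in 'C(N) -> x = 1.
  by move=> Px cNx; apply: cPy Px _; apply: (centP cNx).
have [q Pq cNw] := factor nNc Pc; set w := q^-1 * c in cNw.
have Dc : c = q * w by rewrite mulKVg.
clearbody w.
have PM x v : x \in P -> v \in P -> x * v \in P by apply: groupM.
have CM x v : x \in 'C(N) -> v \in 'C(N) -> x * v \in 'C(N) by apply: groupM.
have cPN x v : x \in P -> v \in 'C(N) -> commute x v.
  by move=> Px cNv; apply/commute_sym/(centP cNv)/(subsetP (subsetIl _ _) x Px).
(* As [P] meets ['C(N)] trivially and commutes with it, every relation between products splits into
   one in [P] and one in ['C(N)]. *)
have uniq_fact x v x' v' : x \in P -> v \in 'C(N) -> x' \in P -> v' \in 'C(N) ->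
    x * v = x' * v' -> x = x' /\ v = v'.
  move=> Px cv Px' cv' eqxv; have xx' : x'^-1 * x = 1.
    apply: tiPC; first by rewrite groupM ?groupV.
    rewrite (_ : _ * _ = v' * v^-1) ?groupM ?groupV //.
    by apply: (mulgI x'); rewrite mulKVg mulgA -eqxv mulgK.
  have eqx : x = x' by apply: (mulgI x'^-1); rewrite xx' mulVg.
  by split=> //; apply: (mulgI x); rewrite {2}eqx.
have PJ x g : x \in P -> g \in 'N(N) -> x ^ g \in P.
  by move=> Px nNg; rewrite -(conjP nNg) memJ_conjg.
have CJ v g : v \in 'C(N) -> g \in 'N(N) -> v ^ g \in 'C(N).
  by move=> cv nNg; rewrite memJ_norm // (subsetP (cent_norm N)).
have [q2 w2] : q ^+ 2 = 1 /\ w ^+ 2 = 1.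
  apply: uniq_fact; rewrite ?group1 ?groupX // mulg1 -expgMn -?Dc //.
  exact: cPN.
have [Pqt cNwt] : q ^ t \in P /\ w ^ t \in 'C(N).
  by split; [apply: PJ | apply: CJ].
have Dd : c ^ t = q ^ t * w ^ t by rewrite Dc conjMg.
have mul_fact x v x' v' : x \in P -> v \in 'C(N) -> x' \in P -> v' \in 'C(N) ->
    (x * v) * (x' * v') = (x * x') * (v * v').
  move=> Px cv Px' cv'; rewrite -!mulgA; congr (_ * _).
  by rewrite !mulgA (cPN x' v).
have cqq : commute q (q ^ t) by apply: (centsP abelP).
have [_ cww] : q * q ^ t = q ^ t * q /\ w * w ^ t = w ^ t * w.
  apply: (uniq_fact _ _ _ _ (PM _ _ Pq Pqt) (CM _ _ cNw cNwt)
    (PM _ _ Pqt Pq) (CM _ _ cNwt cNw)).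
  by rewrite -(mul_fact q w) // -(mul_fact (q ^ t) (w ^ t)) // -Dc -Dd.
have [qtt wtt] : (q ^ t) ^ t = q * q ^ t /\ (w ^ t) ^ t = w * w ^ t.
  apply: (uniq_fact _ _ _ _ (PJ _ t Pqt nNt) (CJ _ t cNwt nNt)
    (PM _ _ Pq Pqt) (CM _ _ cNw cNwt)).
  by rewrite -(mul_fact q w) // -Dc -Dd -dt Dd -conjMg.
have q1 : q != 1.
  apply: contraPneq card_centc => q1; rewrite (setIidPl _) ?cardN //.
  by rewrite sub_cent1 Dc q1 mul1g.
have w1 : w != 1.
  apply: contraNneq notNc => w1; rewrite Dc w1 mulg1.
  exact: (subsetP (subsetIl _ _)) Pq.
have defP : klein_group q t = P.
  apply/eqP; rewrite eqEcard card_centc card_klein_group // leqnn andbT.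
  by rewrite join_subG !cycle_subG Pq.
have [qz wz] : q ^ z = q /\ w ^ z = w.
  apply: uniq_fact; rewrite ?PJ ?CJ // -conjMg -Dc.
  by apply/conjg_fixP/commgP/commute_sym.
have tz x : x ^ z = x -> (x ^ t) ^ z = x ^ t.
  by move=> xz; rewrite -conjgM -czt conjgM xz.
have cent_klein x : x ^ z = x -> klein_group x t \subset 'C[z].
  move=> xz; rewrite join_subG !cycle_subG.
  by apply/andP; split; apply/cent1P/commgP/conjg_fixP; rewrite ?tz.
have cPz : z \in 'C(P) by rewrite -sub_cent1 -defP cent_klein.
have [r Pr] := factor nNz cPz; set v := r^-1 * z => cNv.
have Dz : z = r * v by rewrite mulKVg.
have [rt vt] : r ^ t = r /\ v ^ t = v.
  apply: uniq_fact; rewrite ?PJ ?CJ // -conjMg -Dz.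
  exact/conjg_fixP/commgP.
have r1 : r = 1.
  by apply: (klein_group_fix (a := q) (t := t)) => //; rewrite defP.
have cNz : z \in 'C(N) by rewrite Dz r1 mul1g.
have zt : z ^ t = z by apply/conjg_fixP/commgP.
have notKz : z \notin klein_group w t.
  by apply: contra z1 => Kz; apply/eqP; apply: klein_group_fix Kz zt.
have oz : #[z] = 2 by apply: nt_prime_order.
have tizK : <[z]> :&: klein_group w t = 1.
  by apply: prime_TIg; rewrite -?orderE ?oz // cycle_subG.
have cKz : klein_group w t \subset 'C(<[z]>) by rewrite cent_cycle cent_klein.
have: #|<[z]> <*> klein_group w t| %| 12.
  apply: dvdn_trans card_cent; apply: cardSg.
  by rewrite !join_subG !cycle_subG cNz cNw.
by rewrite cent_joinEr // TI_cardMg // card_klein_group // -orderE oz.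
Qed.

End NoRegularSubgroup.

(** * The right cosets of a subgroup as a permutation domain *)

Section CosetSpace.
Local Open Scope group_scope.
Variables (gT : finGroupType) (U : {group gT}).
Implicit Types g h : gT.

(** A finite type of its own, so that its permutations are exactly those of the cosets and
    regularity can be stated for all points. *)
Definition coset_space := {A : {set gT} | A \in rcosets U [set: gT]}.
Implicit Type x : coset_space.

Fact coset_pt_subproof g : U :* g \in rcosets U [set: gT].
Proof. by apply/rcosetsP; exists g; rewrite ?inE. Qed.

Definition coset_pt g : coset_space := Sub (U :* g) (coset_pt_subproof g).

Lemma coset_ptP g h : reflect (coset_pt g = coset_pt h) (g * h^-1 \in U).
Proof.
rewrite -mem_rcoset; apply: (iffP idP) => [/rcoset_eqP eqU | /(congr1 val) /= <-].
  exact: val_inj.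
exact: rcoset_refl.
Qed.

Definition coset_pt_repr x : gT := repr (val x).

Lemma coset_pt_reprK x : coset_pt (coset_pt_repr x) = x.
Proof.
apply: val_inj; have /rcosetsP[g _ Dx] := valP x.
by rewrite /= /coset_pt_repr Dx rcoset_repr.
Qed.

Definition coset_shift g x := coset_pt (coset_pt_repr x * g).

Lemma coset_shiftE g h : coset_shift g (coset_pt h) = coset_pt (h * g).
Proof.
apply/coset_ptP; rewrite invMg mulgA mulgK; apply/coset_ptP.
exact: coset_pt_reprK.
Qed.

Fact coset_shift_inj g : injective (coset_shift g).
Proof.
move=> x y; rewrite -(coset_pt_reprK x) -(coset_pt_reprK y) !coset_shiftE.
by move/coset_ptP; rewrite invMg mulgA mulgK => /coset_ptP.
Qed.

Definition coset_perm g : {perm coset_space} := perm (@coset_shift_inj g).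

Lemma coset_permE g h : coset_perm g (coset_pt h) = coset_pt (h * g).
Proof. by rewrite permE coset_shiftE. Qed.

Lemma coset_permM g h : coset_perm (g * h) = coset_perm g * coset_perm h.
Proof.
by apply/permP=> x; rewrite -(coset_pt_reprK x) permM !coset_permE mulgA.
Qed.

Lemma coset_perm1 : coset_perm 1 = 1.
Proof. by apply: (mulgI (coset_perm 1)); rewrite -coset_permM !mulg1. Qed.

Lemma coset_permV g : coset_perm g^-1 = (coset_perm g)^-1.
Proof.
by apply: (mulgI (coset_perm g)); rewrite -coset_permM !mulgV coset_perm1.
Qed.

Lemma card_coset_space : #|{: coset_space}| = #|[set: gT] : U|.
Proof. by rewrite card_sig; apply: eq_card => A; rewrite inE. Qed.

End CosetSpace.


(** * Centralizers of regular permutation groups *)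

Section RegularPermGroup.
Local Open Scope group_scope.
Variables (X : finType) (N : {group {perm X}}) (x0 : X).
Hypothesis transN : forall x y, exists2 p, p \in N & p x = y.
Hypothesis semiregN : forall (p : {perm X}) x, p \in N -> p x = x -> p = 1.

Lemma regular_orbit_inj : {in N &, injective (fun p : {perm X} => p x0)}.
Proof.
move=> p q Np Nq /= eqpq; apply/eqP; rewrite eq_mulgV1; apply/eqP.
by apply: (semiregN (x := x0)); rewrite ?groupM ?groupV // permM eqpq permK.
Qed.

Lemma card_regular : #|N| = #|X|.
Proof.
rewrite -(card_in_imset regular_orbit_inj); apply: eq_card => x.
by have [p Np <-] := transN x0 x; rewrite imset_f.
Qed.

(** Since [c] fixes [x0], the bijection [p |-> p x0] from [N] to [X] carries conjugation by [c] to
    the action of [c]. *)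
Lemma card_regular_cent (c : {perm X}) : c \in 'N(N) -> c x0 = x0 ->
  #|'C_N[c]| = #|[set x | c x == x]|.
Proof.
move=> nNc cx0.
have inj := sub_in2 (subsetP (subsetIl N 'C[c])) regular_orbit_inj.
rewrite -(card_in_imset inj); apply: eq_card => x; rewrite !inE.
apply/imsetP/eqP => [[p /setIP[_ /cent1P cp] ->] | cx].
  by rewrite -permM cp permM cx0.
have [p Np px0] := transN x0 x; exists p => //; apply/setIP; split=> //.
apply/cent1P/commgP/conjg_fixP/regular_orbit_inj; rewrite ?memJ_norm //.
by rewrite -{1}cx0 permJ px0.
Qed.

(** The centralizer of a transitive group is semiregular, so all its orbits have [#|'C(N)|]
    points. *)
Lemma card_cent_regular : #|'C(N)| %| #|X|.
Proof.
have semiC (p : {perm X}) x : p \in 'C(N) -> p x = x -> p = 1.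
  move=> /centP cNp px; apply/permP=> y; have [q Nq <-] := transN x y.
  by rewrite perm1 -permM -cNp // permM px.
have orbitP : partition (orbit 'P 'C(N) @: [set: X]) [set: X].
  by apply: orbit_partition; apply/actsP=> p _ x; rewrite !inE.
rewrite -cardsT (card_uniform_partition (n := #|'C(N)|) _ orbitP) ?dvdn_mull //.
move=> _ /imsetP[x _ ->]; rewrite card_orbit -[RHS]indexg1; congr #|_ : _|.
apply/trivgP/subsetP=> p /setIP[Cp /astab1P px].
by apply/set1P; apply: (semiC p x Cp); exact: px.
Qed.

End RegularPermGroup.

(** * Regular groups on twelve cosets *)

Section NoRegularOnCosets.
Local Open Scope group_scope.
Variables (gT : finGroupType) (U : {group gT}) (c t z : gT).
Hypotheses (cardG : #|[set: gT]| = 48%N) (cardU : #|U| = 4%N).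
Hypotheses (Uc : c \in U) (cUc : c \in 'C(U)) (cardC : #|'C[c]| = 16%N).
Hypothesis Uconj : forall g, c ^ g \in U -> g \in 'C[c].
Hypotheses (c2 : c ^+ 2 = 1) (ccd : commute c (c ^ t)).
Hypothesis dt : (c ^ t) ^ t = c * c ^ t.
Hypotheses (z2 : z ^+ 2 = 1) (Uz : z \notin U).
Hypotheses (czc : commute z c) (czt : commute z t).
Local Notation lam := (coset_perm U).

Lemma no_regular_on_cosets (N : {group {perm coset_space U}}) :
  (forall x y, exists2 p, p \in N & p x = y) ->
  (forall (p : {perm coset_space U}) x, p \in N -> p x = x -> p = 1) ->
  (forall g, lam g \in 'N(N)) -> False.
Proof.
move=> transN semiN nNl.
have cardX : #|{: coset_space U}| = 12%N.
  by rewrite card_coset_space -divgS ?subsetT // cardG cardU.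
pose x0 := coset_pt U 1.
have fixc : lam c x0 = x0.
  by rewrite coset_permE mul1g; apply/coset_ptP; rewrite invg1 mulg1.
(* The coset of [h] is fixed by [c] exactly if [c ^ h^-1] lies in [U], that is, if [h] centralizes
   [c]. This makes 16 / 4 fixed cosets. *)
have card_fix : #|[set x | lam c x == x]| = 4%N.
  have <- : #|'C[c] : U| = 4%N.
    by rewrite -divgS ?sub_cent1 // cardC cardU.
  rewrite -(card_imset _ val_inj) /indexg; apply: eq_card => A.
  have fixP h : (lam c (coset_pt U h) == coset_pt U h) = (h \in 'C[c]).
    rewrite coset_permE; apply/eqP/idP => [/coset_ptP | /cent1P hc].
      by rewrite -mulgA -{1}[h]invgK -conjgE => /Uconj; rewrite groupV.
    by rewrite hc; apply/coset_ptP; rewrite mulgK.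
  apply/imsetP/rcosetsP => [[x] | [g Cg ->]].
    rewrite inE -(coset_pt_reprK x) fixP => Cx ->.
    by exists (coset_pt_repr x).
  by exists (coset_pt U g); rewrite ?inE ?fixP.
have fix1 p : p \in N -> p x0 = x0 -> p = 1 by apply: semiN.
have cardN : #|N| = 12%N by rewrite (card_regular x0 transN semiN).
have lamX g n : lam (g ^+ n) = lam g ^+ n.
  by elim: n => [|n IHn]; rewrite ?coset_perm1 // !expgS coset_permM IHn.
have lamJ g h : lam (g ^ h) = lam g ^ lam h.
  by rewrite !conjgE !coset_permM coset_permV.
have lamC g h : commute g h -> commute (lam g) (lam h).
  by move=> gh; rewrite /commute -!coset_permM gh.
apply: (@no_regular_subgroup _ N (lam c) (lam t) (lam z)) => //.
- by rewrite -cardX; apply: card_cent_regular.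
(* If it were in [N], the image of [c] would be the identity by semiregularity, with 12 fixed points
   instead of 4. *)
- apply/negP=> Nc; have := card_fix; rewrite (fix1 _ Nc fixc).
  rewrite (eq_card (_ : _ =i predT)) ?cardX // => x.
  by rewrite !inE perm1 eqxx.
- by rewrite (card_regular_cent transN semiN _ fixc).
- by rewrite -lamX c2 coset_perm1.
- by rewrite -lamJ; apply: lamC.
- by rewrite -!lamJ dt coset_permM lamJ.
- apply: contra Uz => /eqP lz1; have := coset_permE U z 1.
  by rewrite lz1 perm1 mul1g => /esym/coset_ptP; rewrite invg1 mulg1.
- by rewrite -lamX z2 coset_perm1.
- exact: lamC.
- exact: lamC.
Qed.

End NoRegularOnCosets.

(** * The permutation group 6T11 *)

Lemma perm_enum_image (I : finType) (T : eqType) (f : I -> T) (s : seq T) :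
  injective f -> uniq s -> (forall i, f i \in s) ->
  (forall x, x \in s -> exists i, f i = x) -> perm_eq [seq f i | i <- enum I] s.
Proof.
move=> f_inj us fs onto; apply: uniq_perm => //.
  by rewrite map_inj_uniq ?enum_uniq.
move=> x; apply/mapP/idP => [[i _ ->] // | /onto[i <-]].
by exists i; rewrite ?mem_enum.
Qed.

Section PermutationCodes.
Local Open Scope nat_scope.

(** A permutation is coded by the list of its values; the left factor acts first, as in
    [{perm _}]. *)
Definition comp6 (l m : seq nat) := [seq nth 0 m i | i <- l].

Definition gens6 : seq (seq nat) :=
  [:: [:: 0; 1; 5; 3; 4; 2]; [:: 2; 3; 4; 5; 0; 1]; [:: 4; 3; 2; 1; 0; 5]].

Definition extend6 (s : seq (seq nat)) :=
  undup (s ++ [seq comp6 l g | l <- s, g <- gens6]).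

(* Eight rounds reach the closure, which has 48 elements. *)
Definition codes6 := iter 8 extend6 [:: iota 0 6].

Definition fix0 (l : seq nat) := nth 0 l 0 == 0.

Definition comm6 (l m : seq nat) := comp6 l m == comp6 m l.

Definition c6 := [:: 0; 4; 5; 3; 1; 2].
Definition r6 := [:: 0; 5; 1; 3; 2; 4].
Definition t6 := [:: 2; 3; 4; 5; 0; 1].
Definition z6 := [:: 3; 4; 5; 0; 1; 2].
Definition u6 := [:: 0; 4; 2; 3; 1; 5].

(* The determinant of the signed permutation matrix: the number of sign changes
   plus the number of inversions of the permutation of the blocks {i, i + 3}. *)
Definition rotation6 (l : seq nat) :=
  let m := [seq i %% 3 | i <- take 3 l] in
  ~~ odd (count (leq 3) (take 3 l) +
          ((nth 0 m 1 < nth 0 m 0) + (nth 0 m 2 < nth 0 m 0)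
           + (nth 0 m 2 < nth 0 m 1))).

(* 6T11 is the full symmetry group of the cube, acting on the faces with
   opposite faces i and i + 3: S is the stabilizer of a face, N the rotation
   group, z the central inversion, r and c the quarter and half turns about the
   fixed face, t a rotation of order 3 and u a reflection. *)
Record octahedral (gT : finGroupType) (S N : {group gT}) (c r t z u : gT) :
    Prop := Octahedral {
  card_octahedral : #|[set: gT]| = 48;
  oct_r : r \in S;
  oct_r2 : (r ^+ 2 = c)%g;
  oct_c1 : (c != 1)%g;
  oct_c2 : (c ^+ 2 = 1)%g;
  oct_ccd : commute c (c ^ t)%g;
  oct_dt : ((c ^ t) ^ t = c * c ^ t)%g;
  oct_z2 : (z ^+ 2 = 1)%g;
  oct_Sz : z \notin S;
  oct_czc : commute z c;
  oct_czt : commute z t;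
  oct_cSc : c \in 'C(S)%g;
  oct_conj : forall g, (c ^ g)%g \in S -> g \in 'C[c]%g;
  oct_cardC : #|'C[c]%g| = 16;
  oct_cardN : #|N| = 24;
  oct_Nc : c \in N;
  oct_Ninv : forall x, x \in S -> x \in N -> (x ^+ 2 = 1)%g -> x = 1%g \/ x = c;
  oct_center : forall x, x \in S -> x \in 'C(S)%g -> x = 1%g \/ x = c;
  oct_u : [/\ u \in S, (u ^+ 2 = 1)%g, u <> 1%g & u <> c]
}.

(** * Properties of the octahedral group, decided on the 48 codes *)

Section OctahedralCode.
Variables (gT : finGroupType) (S : {group gT}) (code : gT -> seq nat).
Hypothesis code_inj : injective code.
Hypothesis codeM : forall g h, code (g * h)%g = comp6 (code g) (code h).
Hypothesis code_mem : forall g, code g \in codes6.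
Hypothesis code_onto : forall l, l \in codes6 -> exists g, code g = l.
Hypothesis code_fix0 : forall g, (g \in S) = fix0 (code g).

Let code1 : code 1%g = iota 0 6.
Proof.
have [g Dg] : exists g, code g = iota 0 6 by apply: code_onto; vm_compute.
suff -> : 1%g = g by [].
by apply: (mulgI g); rewrite mulg1; apply: code_inj; rewrite codeM Dg; vm_compute.
Qed.

Let perm_codes : perm_eq [seq code g | g <- enum gT] codes6.
Proof. apply: perm_enum_image code_inj _ code_mem code_onto.
by vm_compute.
 Qed.

Let card_code (P : pred (seq nat)) (A : {pred gT}) :
  (forall g, (g \in A) = P (code g)) -> #|A| = count P codes6.
Proof.
move=> AP; rewrite -(seq.permP perm_codes) count_map -size_filter cardE enumT.
by rewrite /enum_mem; congr size; apply: eq_filter => g; apply: AP.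
Qed.

Let check1 (P : pred (seq nat)) g : all P codes6 -> P (code g).
Proof. by move/allP; apply; apply: code_mem. Qed.

Let check2 (P : rel (seq nat)) g h :
  all (fun l => all (P l) codes6) codes6 -> P (code g) (code h).
Proof. by move=> /allP/(_ _ (code_mem g)); apply: check1. Qed.

Let commuteE g h : comm6 (code g) (code h) -> commute g h.
Proof. by move/eqP=> gh; apply: code_inj; rewrite !codeM. Qed.

Let commuteP g h : commute g h -> comm6 (code g) (code h).
Proof. by rewrite /comm6 -!codeM => ->. Qed.

Let rotations := [set g | rotation6 (code g)].

Let rotations_group : group_set rotations.
Proof.
apply/group_setP; split; first by rewrite inE code1; vm_compute.
move=> g h; rewrite !inE codeM => Rg Rh.
have := check2 (P := fun l m => rotation6 l ==> rotation6 m ==>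
  rotation6 (comp6 l m)) g h.
by rewrite Rg Rh; apply; vm_compute.
Qed.

Lemma octahedral_code : exists (N : {group gT}) (c r t z u : gT),
  octahedral S N c r t z u.
Proof.
have [c Dc] : exists g, code g = c6 by apply: code_onto; vm_compute.
have [r Dr] : exists g, code g = r6 by apply: code_onto; vm_compute.
have [t Dt] : exists g, code g = t6 by apply: code_onto; vm_compute.
have [z Dz] : exists g, code g = z6 by apply: code_onto; vm_compute.
have [u Du] : exists g, code g = u6 by apply: code_onto; vm_compute.
(* The half turn [c ^ t] about a second axis, through the faces 2 and 5. *)
have [d Dd] : exists g, code g = [:: 3; 4; 2; 0; 1; 5].
  by apply: code_onto; vm_compute.
have ct : (c ^ t = d)%g.
  apply: (mulgI t); rewrite -conjgC; apply: code_inj.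
  by rewrite !codeM Dc Dt Dd; vm_compute.
have dt : (d ^ t = c * d)%g.
  apply: (mulgI t); rewrite -conjgC; apply: code_inj.
  by rewrite !codeM Dc Dt Dd; vm_compute.
have r2 : (r ^+ 2 = c)%g.
  by apply: code_inj; rewrite expgS expg1 codeM Dr Dc; vm_compute.
have c2 : (c ^+ 2 = 1)%g.
  by apply: code_inj; rewrite expgS expg1 codeM code1 Dc; vm_compute.
have z2 : (z ^+ 2 = 1)%g.
  by apply: code_inj; rewrite expgS expg1 codeM code1 Dz; vm_compute.
have u2 : (u ^+ 2 = 1)%g.
  by apply: code_inj; rewrite expgS expg1 codeM code1 Du; vm_compute.
exists (Group rotations_group), c, r, t, z, u; split=> //.
- by rewrite (card_code (P := predT)) => [|g]; [vm_compute | rewrite inE].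
- by rewrite code_fix0 Dr; vm_compute.
- by apply/eqP=> c1; have := Dc; rewrite c1 code1; vm_compute.
- by rewrite ct; apply: commuteE; rewrite Dc Dd; vm_compute.
- by rewrite ct.
- by rewrite code_fix0 Dz; vm_compute.
- by apply: commuteE; rewrite Dz Dc; vm_compute.
- by apply: commuteE; rewrite Dz Dt; vm_compute.
- apply/centP=> x; rewrite code_fix0 => Sx; apply: commuteE; rewrite Dc.
  move: Sx; apply/implyP.
  by apply: (check1 (P := fun l => fix0 l ==> comm6 c6 l)); vm_compute.
(* The conjugate enters through [c * g = g * c ^ g], which involves products only. *)
- move=> g; rewrite code_fix0 => Scg; apply/cent1P/commuteE.
  have cg : comp6 c6 (code g) == comp6 (code g) (code (c ^ g)%g).
    by rewrite -Dc -!codeM -conjgC.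
  rewrite Dc; apply: (implyP (check2 (P := fun l m =>
    (fix0 m && (comp6 c6 l == comp6 l m)) ==> comm6 l c6) g (c ^ g)%g _)).
    by vm_compute.
  by rewrite Scg.
- rewrite (card_code (P := comm6 c6)) => [|g]; first by vm_compute.
  rewrite -Dc; apply/cent1P/idP => [/commute_sym/commuteP // |].
  by move/commuteE/commute_sym.
- by rewrite (card_code (P := rotation6)) => [|g]; [vm_compute | rewrite inE].
- by rewrite inE Dc; vm_compute.
- move=> x; rewrite code_fix0 inE => Sx Rx x2.
  have: comp6 (code x) (code x) == iota 0 6 by rewrite -codeM -code1 -x2.
  have := check1 (P := fun l => [&& fix0 l, rotation6 l & comp6 l l == iota 0 6] ==>
    ((l == iota 0 6) || (l == c6))) x.
  move/(_ isT)/implyP => chk xx; have /orP[] := chk (introT and3P (And3 Sx Rx xx)).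
    by rewrite -code1 => /eqP/code_inj; left.
  by rewrite -Dc => /eqP/code_inj; right.
- move=> x; rewrite code_fix0 => Sx /centP cSx.
  have cx y : fix0 (code y) -> comm6 (code x) (code y).
    by rewrite -code_fix0 => /cSx; apply: commuteP.
  (* Commuting with [r] and [u] alone already leaves only the identity and [c]. *)
  have := check1 (P := fun l => [&& fix0 l, comm6 l r6 & comm6 l u6] ==>
    ((l == iota 0 6) || (l == c6))) x.
  move/(_ isT)/implyP => chk.
  have xr : comm6 (code x) r6 by rewrite -Dr; apply: cx; rewrite Dr; vm_compute.
  have xu : comm6 (code x) u6 by rewrite -Du; apply: cx; rewrite Du; vm_compute.
  have /orP[] := chk (introT and3P (And3 Sx xr xu)).
    by rewrite -code1 => /eqP/code_inj; left.
  by rewrite -Dc => /eqP/code_inj; right.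
- split=> //.
  + by rewrite code_fix0 Du; vm_compute.
  + by move=> u1; have := Du; rewrite u1 code1; vm_compute.
  + by move=> uc; have := Du; rewrite uc Dc; vm_compute.
Qed.

End OctahedralCode.

Definition code6 (p : {perm 'I_6}) := [seq val (p (inord i)) | i <- iota 0 6].

Lemma nth_code6 (p : {perm 'I_6}) (i : 'I_6) : nth 0 (code6 p) i = p i.
Proof.
by rewrite (nth_map 0) ?size_iota // nth_iota // add0n inord_val.
Qed.

Lemma code6_inj : injective code6.
Proof.
by move=> p q eqpq; apply/permP=> i; apply: val_inj; rewrite /= -!nth_code6 eqpq.
Qed.

Lemma code6M p q : code6 (p * q)%g = comp6 (code6 p) (code6 q).
Proof.
rewrite /comp6 -map_comp; apply: eq_map => i /=.
by rewrite nth_code6 permM.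
Qed.

Lemma fix0_code6 p : fix0 (code6 p) = (p (inord 0) == inord 0).
Proof. by rewrite /fix0 /= -val_eqE /= inordK. Qed.

Lemma code6_transp i j : i < 6 -> j < 6 -> code6 (transp6 i j) =
  [seq if a == i then j else if a == j then i else a | a <- iota 0 6].
Proof.
move=> i6 j6; apply/eq_in_map => a; rewrite mem_iota => /= a6.
by rewrite permE /= -!val_eqE /= !inordK // !(fun_if val) /= !inordK.
Qed.

Lemma code6_1 : code6 1%g = iota 0 6.
Proof.
rewrite -[RHS]map_id; apply/eq_in_map => a; rewrite mem_iota => /= a6.
by rewrite perm1 inordK.
Qed.

Lemma code6_gens : [seq code6 p | p <- [:: transp6 2 5;
  transp6 0 2 * transp6 0 4 * (transp6 1 3 * transp6 1 5);
  transp6 0 4 * transp6 1 3]%g] = gens6.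
Proof. by rewrite /= !code6M !code6_transp. Qed.

(** The list [codes6] is closed under [comp6], so the permutations coded in it form a group, and
    this group contains the generators. *)
Lemma group6T11_code p : p \in group6T11 -> code6 p \in codes6.
Proof.
have gK : group_set [set p | code6 p \in codes6].
  apply/group_setP; split; first by rewrite in_set code6_1; vm_compute.
  move=> q r; rewrite !in_set code6M => Kq Kr.
  have /allP/(_ _ Kq)/allP : all (fun l => all (fun m =>
    comp6 l m \in codes6) codes6) codes6 by vm_compute.
  by apply.
suff /subsetP sub : group6T11 \subset Group gK by move/sub; rewrite in_set.
have gen q : code6 q \in gens6 -> q \in Group gK.
  by rewrite in_set; move: (code6 q) => l; apply/allP; vm_compute.
rewrite gen_subG; apply/subsetP=> q Dq; apply: gen.
by rewrite -code6_gens map_f //; move: Dq; rewrite !inE -orbA.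
Qed.

(** Each round only multiplies by generators on the right, so by induction no code leaves the
    group. *)
Lemma code6_onto l : l \in codes6 -> exists2 p, p \in group6T11 & code6 p = l.
Proof.
rewrite /codes6; elim: 8 l => [l|n IHn l].
  by rewrite inE => /eqP->; exists 1%g; rewrite ?group1 ?code6_1.
rewrite iterS mem_undup mem_cat => /orP[/IHn // | /allpairsP[[m g] /= [mn]]].
have [p Gp <-] := IHn m mn.
rewrite -code6_gens => /mapP[q Gq ->] ->; exists (p * q)%g; rewrite ?code6M //.
by rewrite groupM // mem_gen //; move: Gq; rewrite !inE -orbA.
Qed.

End PermutationCodes.

(** Transporting translation along [f] gives [psi] from [G] onto [group6T11]; its kernel is the core
    of [S], which is trivial. Under [psi] the group [S] stabilizes [i0]; conjugating by some [q]
    that takes 0 to [i0] makes it the stabilizer of 0. *)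
Lemma perm_isomorphic_octahedral (gT : finGroupType) (G S : {group gT}) :
    (forall g, g \in G) ->
    (forall g, (forall x, g ^ x \in S)%g -> g = 1%g) ->
    perm_isomorphic (rcosets S G) (coset_perms G S) group6T11 ->
  exists (N : {group gT}) (c r t z u : gT), octahedral S N c r t z u.
Proof.
move=> GT core1 [f [f_inj f_im f_iff]].
have f_rcoset i : f i \in rcosets S G by rewrite -f_im imset_f.
have shift_ex g : exists p : {perm 'I_6}, forall i, f (p i) = (f i :* g)%g.
  have img i : exists j, f j == (f i :* g)%g.
    have : (f i :* g)%g \in f @: [set: 'I_6].
      rewrite f_im; have /rcosetsP[x _ ->] := f_rcoset i.
      by apply/rcosetsP; exists (x * g)%g; rewrite ?GT // rcosetM.
    by case/imsetP=> j _ ->; exists j.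
  have [s sP] := fin_all_exists img.
  have s_inj : injective s.
    move=> i j sij; apply: f_inj; apply: (rcoset_inj (x := g)).
    by rewrite -(eqP (sP i)) -(eqP (sP j)) sij.
  by exists (perm s_inj) => i; rewrite permE; apply/eqP.
have [psi psiP] := fin_all_exists shift_ex.
have psiM g h : psi (g * h)%g = (psi g * psi h)%g.
  by apply/permP=> i; apply: f_inj; rewrite permM !psiP rcosetM.
have psi6 g : psi g \in group6T11.
  apply/f_iff; exists (coset_translation G S g); first by rewrite imset_f.
  by move=> i; rewrite coset_translationE ?GT.
have psi_onto p : p \in group6T11 -> exists g, psi g = p.
  case/f_iff => _ /imsetP[g _ ->] pg; exists g; apply/permP=> i; apply: f_inj.
  by rewrite pg coset_translationE ?GT.
have psi_inj : injective psi.
  move=> g h eqgh; apply/eqP; rewrite eq_mulgV1; apply/eqP/core1 => x.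
  have : (S :* x^-1)%g \in f @: [set: 'I_6].
    by rewrite f_im; apply/rcosetsP; exists x^-1%g; rewrite ?GT.
  case/imsetP=> i _ Di; have := psiP g i; rewrite eqgh psiP -Di -!rcosetM.
  move/esym/rcoset_eqP; rewrite mem_rcoset invMg invgK.
  by rewrite conjgE !mulgA.
have [i0 Di0] : exists i, f i = S.
  have : (S : {set gT}) \in f @: [set: 'I_6].
    by rewrite f_im; apply/rcosetsP; exists 1%g; rewrite ?GT ?rcoset1.
  by case/imsetP=> i _ ->; exists i.
have [q Gq q0] : exists2 q, q \in group6T11 & q (inord 0) = i0.
  have [l Ll l0] : exists2 l, l \in codes6 & nth 0 l 0 = i0.
    have /allP/(_ (val i0)) : all (fun i => has (fun l => nth 0 l 0 == i) codes6)
      (iota 0 6) by vm_compute.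
    by rewrite mem_iota ltn_ord => /(_ isT)/hasP[l Ll /eqP l0]; exists l.
  have [q Gq ql] := code6_onto Ll; exists q; first exact: Gq.
  apply: val_inj.
  by rewrite /= -l0 -ql -nth_code6 inordK.
apply: (octahedral_code (code := fun g => code6 (psi g ^ q^-1)%g)).
- by move=> g h /code6_inj/conjg_inj/psi_inj.
- by move=> g h; rewrite psiM conjMg code6M.
- by move=> g; apply: group6T11_code; apply: groupJ; rewrite ?groupV.
- move=> l /code6_onto[p Gp <-]; have [g Dg] := psi_onto _ (groupJ Gp Gq).
  by exists g; rewrite Dg conjgK.
move=> g; rewrite fix0_code6.
have -> : (psi g ^ q^-1)%g (inord 0) = (q^-1)%g (psi g i0).
  by rewrite conjgE invgK !permM q0.
rewrite -(inj_eq (@perm_inj _ q)) permKV q0 -(inj_eq f_inj) psiP Di0.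
apply/idP/eqP => [/rcoset_id // | Sg].
by rewrite -Sg rcoset_refl.
Qed.

(** * Translations by a normal complement *)

Section ComplementTranslations.
Local Open Scope group_scope.
Variables (gT : finGroupType) (G U N : {group gT}).
Hypothesis sdG : N ><| U = G.
Local Notation tr := (coset_translation G U).

Lemma coset_translation_on g : perm_on (rcosets U G) (tr g).
Proof. exact: restr_perm_on. Qed.

Lemma coset_translationM : {in G &, {morph tr : g h / g * h}}.
Proof.
move=> g h Gg Gh; apply/permP=> X; rewrite permM.
have [UX | notUX] := boolP (X \in rcosets U G); last first.
  by rewrite !(out_perm (coset_translation_on _)).
rewrite !coset_translationE ?groupM ?rcosetM //.
have /rcosetsP[x Gx ->] := UX; rewrite -rcosetM.
by apply/rcosetsP; exists (x * g); rewrite ?groupM.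
Qed.

Canonical coset_translation_morphism := Morphism coset_translationM.

Lemma complement_translations : exists M : {group {perm {set gT}}},
  [/\ M \subset perm.Sym (rcosets U G), sharply_transitive M (rcosets U G),
      coset_perms G U \subset 'N(M) & M \subset coset_perms G U].
Proof.
have [nsNG sUG defG _ tiNU] := sdprod_context sdG; have sNG := normal_sub nsNG.
exists (tr @* N)%G; have defM : tr @* N = [set tr n | n in N].
  by rewrite /= morphimEsub.
have defCP : coset_perms G U = tr @* G by rewrite /coset_perms morphimEdom.
split=> /=.
- rewrite defM; apply/subsetP=> _ /imsetP[n _ ->].
  by rewrite inE coset_translation_on.
- move=> _ _ /rcosetsP[a Ga ->] /rcosetsP[b Gb ->].
  (* With [a * b^-1 = m * v], the element [n] of [N] satisfies [a * n = m^-1 * a = v * b], so it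
     takes the coset of [a] to that of [b]. *)
  have : a * b^-1 \in N * U by rewrite defG groupM ?groupV.
  case/mulsgP=> m v Nm Uv Dab; pose n := a^-1 * m^-1 * a.
  have Nn : n \in N.
    by rewrite /n -mulgA -conjgE memJ_norm ?groupV // (subsetP (normal_norm nsNG)).
  have Uan : U :* (a * n) = U :* b.
    apply/rcoset_eqP; rewrite mem_rcoset.
    by rewrite /n !mulgA mulgV mul1g -mulgA Dab mulKg.
  clearbody n; have trn x : x \in N -> tr x (U :* a) = U :* (a * x).
    move=> Nx; rewrite coset_translationE ?rcosetM ?(subsetP sNG) //.
    by apply/rcosetsP; exists a.
  exists (tr n); split.
    split; first by rewrite defM imset_f.
    by rewrite trn // Uan.
  move=> s []; rewrite defM => /imsetP[x Nx ->] trx.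
  congr tr; move: trx; rewrite trn // => Uax.
  (* The conjugate [a * (n * x^-1) * a^-1] lies in [U], and in [N] by normality, so it is
     trivial. *)
  have : U :* (a * n) = U :* (a * x) by rewrite Uan.
  move/rcoset_eqP; rewrite mem_rcoset invMg mulgA => Unx.
  apply/eqP; rewrite eq_mulgV1 -(inj_eq (conjg_inj a^-1)) conj1g.
  rewrite -[_ == 1]in_set1 -[[set 1]]/(1 : {set gT}) -tiNU inE.
  apply/andP; split; last by rewrite conjgE invgK !mulgA.
  rewrite memJ_norm; first by rewrite groupM ?groupV.
  by rewrite groupV (subsetP (normal_norm nsNG)).
- by rewrite defCP; apply: morphim_norms (normal_norm nsNG).
by rewrite defCP; apply: morphimS.
Qed.

End ComplementTranslations.

Local Open Scope ring_scope.

(** * Galois forms of group algebras *)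

(** An alias of the function space that carries the convolution product; it is an algebra over [k],
    with coefficients in [A]. *)
Definition group_algebra (k : fieldType) (A : falgType k) (gT : finGroupType) :=
  {ffun gT -> A}.

Section GroupAlgebra.
Variables (k : fieldType) (A : falgType k) (gT : finGroupType).
Local Notation AG := (group_algebra A gT).
Implicit Types a b c : AG.

HB.instance Definition _ := Vector.on AG.

Definition galg_one : AG := [ffun n => (n == 1%g)%:R].
Definition galg_mul a b : AG := [ffun n => \sum_m a m * b (m^-1 * n)%g].

Fact galg_mulA : associative galg_mul.
Proof.
move=> a b c; apply/ffunP=> n; rewrite !ffunE.
under eq_bigr do rewrite ffunE mulr_sumr.
under [RHS]eq_bigr do rewrite ffunE mulr_suml.
rewrite [RHS]exchange_big; apply: eq_bigr => m _ /=.
rewrite (reindex_inj (mulgI m^-1%g)); apply: eq_bigr => l _ /=.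
by rewrite mulrA invMg invgK -!mulgA mulKVg.
Qed.

Fact galg_mul1l : left_id galg_one galg_mul.
Proof.
move=> a; apply/ffunP=> n; rewrite ffunE (bigD1 1%g) //= ffunE eqxx mul1r.
rewrite invg1 mul1g big1 ?addr0 // => m /negPf m1.
by rewrite ffunE m1 mul0r.
Qed.

Fact galg_mul1r : right_id galg_one galg_mul.
Proof.
move=> a; apply/ffunP=> n; rewrite ffunE (bigD1 n) //= ffunE mulVg eqxx mulr1.
rewrite big1 ?addr0 // => m mn.
by rewrite ffunE -eq_mulVg1 (negPf mn) mulr0.
Qed.

Fact galg_mulDl : left_distributive galg_mul +%R.
Proof.
move=> a b c; apply/ffunP=> n; rewrite !ffunE -big_split /=.
by apply: eq_bigr => m _; rewrite ffunE mulrDl.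
Qed.

Fact galg_mulDr : right_distributive galg_mul +%R.
Proof.
move=> a b c; apply/ffunP=> n; rewrite !ffunE -big_split /=.
by apply: eq_bigr => m _; rewrite ffunE mulrDr.
Qed.

Fact galg_one_neq0 : galg_one != 0.
Proof.
by apply/eqP=> /ffunP/(_ 1%g)/eqP; rewrite !ffunE eqxx oner_eq0.
Qed.

HB.instance Definition _ := GRing.Zmodule_isNzRing.Build AG
  galg_mulA galg_mul1l galg_mul1r galg_mulDl galg_mulDr galg_one_neq0.

Fact galg_scaleAl (x : k) a b : x *: (a * b) = x *: a * b.
Proof.
apply/ffunP=> n; rewrite !ffunE scaler_sumr; apply: eq_bigr => m _.
by rewrite ffunE scalerAl.
Qed.

HB.instance Definition _ := GRing.Lmodule_isLalgebra.Build k AG galg_scaleAl.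

Fact galg_scaleAr (x : k) a b : x *: (a * b) = a * (x *: b).
Proof.
apply/ffunP=> n; rewrite !ffunE scaler_sumr; apply: eq_bigr => m _.
by rewrite ffunE scalerAr.
Qed.

HB.instance Definition _ := GRing.Lalgebra_isAlgebra.Build k AG galg_scaleAr.
HB.instance Definition _ := Algebra_isFalgebra.Build k AG.

Lemma galg_oneE n : (1 : AG) n = (n == 1%g)%:R.
Proof. by rewrite ffunE. Qed.

Lemma galg_mulE a b n : (a * b) n = \sum_m a m * b (m^-1 * n)%g.
Proof. by rewrite ffunE. Qed.

End GroupAlgebra.

Record galois_action (k : fieldType) (E : splittingFieldType k)
    (nT : finGroupType) := GaloisAction {
  galois_act :> gal_of {:E} -> nT -> nT;
  galois_act1 : forall n, galois_act 1%g n = n;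
  galois_actJ : forall g h n,
    galois_act (g * h)%g n = galois_act h (galois_act g n);
  galois_actM : forall g m n,
    galois_act g (m * n)%g = (galois_act g m * galois_act g n)%g
}.

(** * Galois descent for group algebras *)

Section GaloisForm.
Variables (k : fieldType) (E : splittingFieldType k) (nT : finGroupType).
Local Notation gT := (gal_of {:E}).
Local Notation AG := (group_algebra E nT).
Variable alpha : galois_action E nT.

Lemma galois_actK g : cancel (alpha g) (alpha g^-1%g).
Proof. by move=> n; rewrite -galois_actJ mulgV galois_act1. Qed.

Lemma galois_actVK g : cancel (alpha g^-1%g) (alpha g).
Proof. by move=> n; rewrite -galois_actJ mulVg galois_act1. Qed.

Lemma galois_act_id g : alpha g 1%g = 1%g.
Proof. by apply: (mulgI (alpha g 1%g)); rewrite -galois_actM !mulg1. Qed.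

Lemma galois_actV g n : alpha g n^-1%g = (alpha g n)^-1%g.
Proof. by apply: (mulgI (alpha g n)); rewrite -galois_actM !mulgV galois_act_id. Qed.

(** The action on coefficients combined with the one on group elements; it is semilinear over [E],
    and its fixed points are the equivariant families. *)
Definition galg_twist (g : gT) (a : AG) : AG :=
  [ffun n => g (a (alpha g^-1%g n))].

Fact galg_twist_linear g : linear (galg_twist g).
Proof. by move=> c a b; apply/ffunP=> n; rewrite !ffunE linearP. Qed.

HB.instance Definition _ g :=
  GRing.isLinear.Build k AG AG *:%R (galg_twist g) (galg_twist_linear g).

Definition galois_form_vspace : {vspace AG} :=
  (\bigcap_(g : gT) fixedSpace (linfun (galg_twist g)))%VS.

Lemma galois_formP (a : AG) :
  reflect (forall (g : gT) n, g (a n) = a (alpha g n)) (a \in galois_form_vspace).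
Proof.
rewrite memvE; apply: (iffP subv_bigcapP) => [fix_a g n | eq_a g _].
  have /fixedSpaceP := fix_a g isT.
  by rewrite lfunE => /ffunP/(_ (alpha g n)); rewrite ffunE galois_actK.
apply/fixedSpaceP; rewrite lfunE; apply/ffunP=> n.
by rewrite ffunE eq_a galois_actVK.
Qed.

Fact galois_form_is_aspace : is_aspace galois_form_vspace.
Proof.
apply/andP; split.
  apply/has_algid1/galois_formP=> g n; rewrite !galg_oneE rmorph_nat.
  by rewrite -(inj_eq (can_inj (galois_actK g))) galois_act_id.
apply/prodvP=> a b /galois_formP Fa /galois_formP Fb.
apply/galois_formP=> g n; rewrite !galg_mulE rmorph_sum /=.
rewrite [RHS](reindex_inj (can_inj (galois_actK g))) /=.
by apply: eq_bigr => m _; rewrite rmorphM /= Fa Fb galois_actM galois_actV.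
Qed.

Definition galois_form : {aspace AG} := ASpace galois_form_is_aspace.

Lemma mem1_galois_form : 1 \in galois_form.
Proof.
apply/galois_formP=> g n; rewrite !galg_oneE rmorph_nat.
by rewrite -(inj_eq (can_inj (galois_actK g))) galois_act_id.
Qed.

Local Notation H := (subvs_of galois_form).

Definition form_coef (n : nT) (h : H) : E := (vsval h : AG) n.

Fact form_coef_linear n : linear (form_coef n).
Proof. by move=> c a b; rewrite /form_coef linearP !ffunE. Qed.

HB.instance Definition _ n :=
  GRing.isLinear.Build k H E *:%R (form_coef n) (form_coef_linear n).

Lemma form_coefJ (g : gT) n h : g (form_coef n h) = form_coef (alpha g n) h.
Proof. by have /galois_formP := subvsP h; apply. Qed.

Lemma form_coef1 n : form_coef n 1 = (n == 1%g)%:R.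
Proof.
rewrite /form_coef -galg_oneE; congr ((_ : AG) n).
by apply/eqP; rewrite algid_eq1 mem1_galois_form.
Qed.

Lemma form_coefM n x y :
  form_coef n (x * y) = \sum_m form_coef m x * form_coef (m^-1 * n)%g y.
Proof. exact: galg_mulE. Qed.

Lemma form_coefP x y : (forall n, form_coef n x = form_coef n y) -> x = y.
Proof. by move=> eqxy; apply/val_inj/ffunP. Qed.

(** Meaningful only for equivariant families; on others the projection gives some element of [H]. *)
Definition form_of (a : nT -> E) : H := vsproj galois_form [ffun n => a n].

Lemma form_ofE (a : nT -> E) n :
  (forall (g : gT) m, g (a m) = a (alpha g m)) -> form_coef n (form_of a) = a n.
Proof.
move=> Fa; rewrite /form_coef vsprojK ?ffunE //.
by apply/galois_formP=> g m; rewrite !ffunE.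
Qed.

Lemma form_of_linear (f : nT -> {linear H -> E}) :
  linear (fun h => form_of (fun n => f n h)).
Proof.
move=> c x y; rewrite /form_of -linearP; congr vsproj.
by apply/ffunP=> n; rewrite !ffunE linearP.
Qed.

Hypothesis galE : galois 1 {:E}.

Lemma gal_fixed_scalar (x : E) : (forall g : gT, g x = x) -> exists c : k, x = c%:A.
Proof.
move=> fix_x; apply/vlineP; rewrite -(galois_fixedField galE).
by apply/fixedFieldP; rewrite ?memvf // => g _; apply: fix_x.
Qed.

Lemma gal_sum_eq0 (c : gT -> E) :
  (forall a, \sum_g c g * g a = 0) -> forall g, c g = 0.
Proof. by move=> sum0 g; apply: (@gal_independent _ _ {:E} predT c) => // a _. Qed.

(** Elements of [H] that are free over [k] stay free over [E]: multiply the relation by [e] and take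
    traces. The coefficients become the traces of [e * v i], which are scalars, so they vanish; as
    [e] is arbitrary, Dedekind independence gives [v i = 0]. *)
Lemma form_basis_free (v : 'I_(\dim {:H}) -> E) :
  (forall n, \sum_i v i * form_coef n (vbasis {:H})`_i = 0) ->
  forall i, v i = 0.
Proof.
move=> sum0.
have tr0 e i : \sum_(g : gT) g (e * v i) = 0.
  have fixT j (g : gT) :
      g (\sum_(h : gT) h (e * v j)) = \sum_(h : gT) h (e * v j).
    rewrite rmorph_sum /= [RHS](reindex_inj (mulIg g)).
    by apply: eq_bigr => h _; rewrite galM ?memvf.
  have [c Dc] := fin_all_exists (fun j => gal_fixed_scalar (fixT j)).
  have: \sum_j c j *: (vbasis {:H})`_j = 0.
    apply: form_coefP => n; rewrite linear_sum [RHS]linear0.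
    (* Applying [g] to the relation at [alpha g^-1 n] brings the coefficients of the basis back to
       [n]. *)
    transitivity (\sum_(g : gT) g (e * \sum_j v j *
        form_coef (alpha g^-1%g n) (vbasis {:H})`_j)).
      under [RHS]eq_bigr do rewrite mulr_sumr rmorph_sum /=.
      rewrite exchange_big; apply: eq_bigr => j _; rewrite linearZ /=.
      rewrite -mulr_algl -Dc mulr_suml; apply: eq_bigr => g _.
      by rewrite mulrA [in RHS]rmorphM /= form_coefJ galois_actVK.
    by rewrite big1 // => g _; rewrite sum0 mulr0 rmorph0.
  move/(freeP (basis_free (vbasisP {:H}))) => c0.
  by rewrite Dc c0 scale0r.
move=> i; have := @gal_sum_eq0 (fun g => g (v i)) _ 1%g; rewrite gal_id.
by apply=> e; rewrite -[RHS](tr0 e i); apply: eq_bigr => g _; rewrite rmorphM mulrC.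
Qed.

Definition form_matrix : 'M[E]_(\dim {:H}, #|nT|) :=
  \matrix_(i, j) form_coef (enum_val j) (vbasis {:H})`_i.

Lemma form_matrix_row_free : row_free form_matrix.
Proof.
rewrite -kermx_eq0; apply/rowV0P => v /sub_kermxP vA0.
apply/rowP=> i; rewrite mxE; apply: (form_basis_free (v := v 0)) => n.
have /rowP/(_ (enum_rank n)) := vA0; rewrite !mxE => vAn.
by rewrite -[RHS]vAn; apply: eq_bigr => j _; rewrite mxE enum_rankK.
Qed.

(** An [E]-linear functional vanishing on [H] is zero. It is tested on [tr e n], the trace under
    [galg_twist] of [e] placed at [n]; letting [e] vary, Dedekind independence kills each term. *)
Lemma form_span (c : nT -> E) :
  (forall h : H, \sum_n form_coef n h * c n = 0) -> forall n, c n = 0.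
Proof.
move=> sum0 n.
pose tr e n m : E := \sum_(g : gT) g e * (alpha g n == m)%:R.
have trJ e (g : gT) m : g (tr e n m) = tr e n (alpha g m).
  rewrite [RHS](reindex_inj (mulIg g)) rmorph_sum; apply: eq_bigr => h _.
  rewrite rmorphM /= rmorph_nat galM ?memvf // galois_actJ.
  by rewrite (inj_eq (can_inj (galois_actK g))).
have := @gal_sum_eq0 (fun g => c (alpha g n)) _ 1%g; rewrite galois_act1; apply=> e.
rewrite -[RHS](sum0 (form_of (tr e n))).
under [RHS]eq_bigr do rewrite form_ofE // mulr_suml.
rewrite exchange_big; apply: eq_bigr => g _ /=.
rewrite (bigD1 (alpha g n)) //= eqxx mulr1 big1 ?addr0 1?mulrC // => m.
by rewrite eq_sym => /negPf->; rewrite mulr0 mul0r.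
Qed.

Lemma form_matrix_row_full : row_full form_matrix.
Proof.
rewrite /row_full -mxrank_tr -/(row_free _) -kermx_eq0.
apply/rowV0P => v /sub_kermxP vA0; apply/rowP=> j; rewrite mxE.
rewrite -(enum_valK j); apply: (form_span (c := fun n => v 0 (enum_rank n))) => h.
rewrite [h](coord_vbasis (memvf h)).
under eq_bigr do rewrite linear_sum mulr_suml /=.
rewrite exchange_big big1 //= => i _.
have /rowP/(_ i) := vA0; rewrite !mxE => vAi.
rewrite -[RHS](scaler0 _ (coord (vbasis {:H}) i h)) -[in RHS]vAi scaler_sumr.
rewrite [RHS](reindex _ (onW_bij _ (enum_rank_bij nT))) /=.
apply: eq_bigr => n' _; rewrite !mxE enum_rankK linearZ /= -scalerAl.
by rewrite [in RHS]mulrC.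
Qed.

Lemma dim_form : \dim {:H} = #|nT|.
Proof.
exact: etrans (esym (eqP form_matrix_row_free)) (eqP form_matrix_row_full).
Qed.

(** The coefficients that express the group element [n] of E[nT] in the [k]-basis of [H]. *)
Definition form_dual n i : E := pinvmx form_matrix (enum_rank n) i.

Lemma form_dualP m n :
  \sum_i form_dual n i * form_coef m (vbasis {:H})`_i = (n == m)%:R.
Proof.
have := mulVpmx form_matrix_row_full; rewrite /form_dual.
move: (pinvmx _) => B /matrixP/(_ (enum_rank n) (enum_rank m)).
rewrite !mxE (inj_eq enum_rank_inj) => <-.
by apply: eq_bigr => i _; rewrite mxE enum_rankK.
Qed.

Lemma form_dualJ (g : gT) n i : g (form_dual n i) = form_dual (alpha g n) i.
Proof.
apply/eqP; rewrite -subr_eq0; apply/eqP; move: i; apply: form_basis_free => m.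
under eq_bigr do rewrite mulrBl -{1}[m](galois_actVK g) -form_coefJ -rmorphM.
rewrite sumrB -rmorph_sum !form_dualP rmorph_nat.
by rewrite -(inj_eq (can_inj (galois_actK g))) galois_actVK subrr.
Qed.

End GaloisForm.

(** * Products of functionals on a tensor product *)

Section TensorForms.
Variables (k : fieldType) (V W : vectType k).

Lemma eq_tens_lift (U : vectType k) (b b' : V -> W -> U) t :
  b =2 b' -> tens_lift b t = tens_lift b' t.
Proof.
by move=> eqb; apply: eq_bigr => i _; apply: eq_bigr => j _; rewrite eqb.
Qed.

Lemma linear_tens_lift (U U' : vectType k) (f : {linear U -> U'})
    (b : V -> W -> U) t :
  f (tens_lift b t) = tens_lift (fun v w => f (b v w)) t.
Proof.
rewrite linear_sum; apply: eq_bigr => i _; rewrite linear_sum.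
by apply: eq_bigr => j _; rewrite linearZ.
Qed.

Lemma tens_lift_sum (U : vectType k) (I : finType) (P : pred I)
    (F : I -> V -> W -> U) t :
  tens_lift (fun v w => \sum_(i | P i) F i v w) t =
  \sum_(i | P i) tens_lift (F i) t.
Proof.
rewrite [RHS]exchange_big; apply: eq_bigr => i _ /=.
rewrite [RHS]exchange_big; apply: eq_bigr => j _ /=.
by rewrite scaler_sumr.
Qed.

Lemma tens_lift_mull (A : falgType k) (x : A) (b : V -> W -> A) t :
  tens_lift (fun v w => x * b v w) t = x * tens_lift b t.
Proof.
rewrite mulr_sumr; apply: eq_bigr => i _; rewrite mulr_sumr.
by apply: eq_bigr => j _; rewrite scalerAr.
Qed.

Lemma tens_lift_mulr (A : falgType k) (x : A) (b : V -> W -> A) t :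
  tens_lift (fun v w => b v w * x) t = tens_lift b t * x.
Proof.
rewrite mulr_suml; apply: eq_bigr => i _; rewrite mulr_suml.
by apply: eq_bigr => j _; rewrite scalerAl.
Qed.

Variable A : falgType k.

Definition tens_form (f : V -> A) (g : W -> A) : tensor V W -> A :=
  tens_lift (fun v w => f v * g w).

HB.instance Definition _ f g := GRing.isLinear.Build k (tensor V W) A *:%R
  (tens_form f g) (tens_lift_linear (fun v w => f v * g w)).

Lemma tens_formE (f : {linear V -> A}) (g : {linear W -> A}) v w :
  tens_form f g (tens v w) = f v * g w.
Proof.
apply: (tens_liftE (b := fun v w => f v * g w)) => [w' | v'] a x y.
  by rewrite linearP mulrDl scalerAl.
by rewrite linearP mulrDr scalerAr.
Qed.

End TensorForms.

(** For fixed [j], the values of [g j] on the rows of the difference are coefficients of a relation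
    between the columns of the [f i], so they vanish. Each row is then killed by all [g j]. *)
Lemma tens_form_inj (k : fieldType) (V W : vectType k) (A : fieldExtType k)
    (I J : Type) (f : I -> {linear V -> A}) (g : J -> {linear W -> A}) :
  (forall v : 'I_(\dim {:V}) -> A,
     (forall i, \sum_l v l * f i (vbasis {:V})`_l = 0) -> forall l, v l = 0) ->
  (forall w, (forall j, g j w = 0) -> w = 0) ->
  forall s t : tensor V W,
    (forall i j, tens_form (f i) (g j) s = tens_form (f i) (g j) t) -> s = t.
Proof.
move=> f_free g_inj s t eq_st; apply/eqP; rewrite -subr_eq0; apply/eqP.
have: forall i j, tens_form (f i) (g j) (s - t) = 0.
  by move=> i j; rewrite linearB /= eq_st subrr.
move: (s - t) => d d0; apply/matrixP=> l m; rewrite mxE.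
apply: (freeP (basis_free (vbasisP {:W})) (fun m => d l m)).
apply: g_inj => j; rewrite linear_sum /=.
apply: (f_free (fun l => \sum_i g j (d l i *: (vbasis {:W})`_i))) => i.
rewrite -[RHS](d0 i j); apply: eq_bigr => l' _; rewrite mulr_suml.
by apply: eq_bigr => m' _; rewrite linearZ -scalerAl mulrC.
Qed.

(** * The Hopf algebra of fixed points *)

Section FormHopfAlgebra.
Variables (k : fieldType) (E : splittingFieldType k) (nT : finGroupType).
Variables (alpha : galois_action E nT) (galE : galois 1 {:E}).
Local Notation gT := (gal_of {:E}).
Local Notation H := (subvs_of (galois_form alpha)).
Local Notation HH := (tensor H H).
Local Notation B := (form_dual (alpha := alpha)).

(** A linear functional on [E] of which only the values on [k] matter: it reads an invariant element
    as a scalar. *)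
Definition scalar_part (x : E) : k := coord [tuple 1] ord0 x.

Lemma scalar_partE (x : E) :
  (forall g : gT, g x = x) -> (scalar_part x)%:A = x.
Proof.
case/(gal_fixed_scalar galE)=> c ->; rewrite /scalar_part linearZ.
have free1 : free [tuple (1 : E)] by rewrite seq1_free oner_eq0.
have /= -> := coord_free (X := [tuple 1]) ord0 ord0 free1.
by congr (_ *: _); apply: mulr1.
Qed.

Lemma scalar_partP (c : k) x y :
  scalar_part (c *: x + y) = c * scalar_part x + scalar_part y.
Proof. exact: linearP. Qed.

Definition form_pair m n : HH -> E :=
  tens_form (form_coef (alpha := alpha) m) (form_coef n).

HB.instance Definition _ m n := GRing.Linear.on (form_pair m n).

Lemma form_pair_tens m n x y :
  form_pair m n (tens x y) = form_coef m x * form_coef n y.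
Proof. exact: tens_formE. Qed.

Lemma form_pair_inj (s t : HH) :
  (forall m n, form_pair m n s = form_pair m n t) -> s = t.
Proof.
apply: tens_form_inj; first exact: form_basis_free.
by move=> w w0; apply: form_coefP => j; rewrite w0 linear0.
Qed.

Lemma form_triple_inj (s t : tensor H HH) :
  (forall l m n, tens_form (form_coef l) (form_pair m n) s =
                 tens_form (form_coef l) (form_pair m n) t) -> s = t.
Proof.
move=> eq_st.
apply: (tens_form_inj (f := form_coef (alpha := alpha))
          (g := fun mn => form_pair mn.1 mn.2)) => [|w w0|l [m n]].
- exact: form_basis_free.
- by apply: form_pair_inj => m n; rewrite (w0 (m, n)) linear0.
- exact: eq_st.
Qed.

(* [\sum_n h_n (n ⊗ n)] in the coordinates of H, found with the dual basis. *)
Definition form_comul (h : H) : HH :=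
  \matrix_(i, j) scalar_part (\sum_n form_coef n h * B n i * B n j).

Fact form_comul_linear : linear form_comul.
Proof.
move=> c x y; apply/matrixP=> i j; rewrite !mxE -scalar_partP.
congr scalar_part; rewrite scaler_sumr -big_split; apply: eq_bigr => n _ /=.
by rewrite linearP !mulrDl -!scalerAl.
Qed.

HB.instance Definition _ :=
  GRing.isLinear.Build k H HH *:%R form_comul form_comul_linear.

(** Over [E], the comultiplication makes the group elements grouplike. The sums defining
    [form_comul] are Galois invariant, so [scalar_part] loses nothing, and the dual basis collapses
    them. *)
Lemma form_pair_comul m n h :
  form_pair m n (form_comul h) = (m == n)%:R * form_coef m h.
Proof.
have coefK i j : (form_comul h i j)%:A = \sum_n form_coef n h * B n i * B n j.
  rewrite mxE scalar_partE // => g; rewrite rmorph_sum.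
  rewrite [RHS](reindex_inj (can_inj (galois_actK alpha g))).
  by apply: eq_bigr => l _; rewrite !rmorphM /= form_coefJ !form_dualJ.
transitivity (\sum_l form_coef l h *
    ((\sum_i B l i * form_coef m (vbasis {:H})`_i) *
     (\sum_j B l j * form_coef n (vbasis {:H})`_j))).
  under [RHS]eq_bigr do rewrite big_distrlr mulr_sumr.
  rewrite [RHS]exchange_big; apply: eq_bigr => i _ /=.
  under [RHS]eq_bigr do rewrite mulr_sumr.
  rewrite [RHS]exchange_big; apply: eq_bigr => j _ /=.
  rewrite -mulr_algl coefK mulr_suml; apply: eq_bigr => l _.
  by rewrite -!mulrA; congr (_ * (_ * _)); rewrite mulrCA.
rewrite (bigD1 m) //= !form_dualP // eqxx mul1r mulrC big1 ?addr0 // => l lm.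
by rewrite !form_dualP // (negPf lm) mul0r mulr0.
Qed.

(** Bilinear expressions in coefficients reduce to their diagonal; this gives multiplicativity of
    the comultiplication and the action on products. *)
Lemma form_tens_lift_comul (F : nT -> nT -> E) h :
  tens_lift (fun a b => \sum_m \sum_n F m n * (form_coef m a * form_coef n b))
    (form_comul h) = \sum_n F n n * form_coef n h.
Proof.
rewrite tens_lift_sum; apply: eq_bigr => m _; rewrite tens_lift_sum.
under eq_bigr => n _ do rewrite tens_lift_mull [tens_lift _ _]form_pair_comul.
rewrite (bigD1 m) //= eqxx mul1r big1 ?addr0 // => n.
by rewrite eq_sym => /negPf->; rewrite mul0r mulr0.
Qed.

Definition form_counit (h : H) : k^o := scalar_part (\sum_n form_coef n h).

Fact form_counit_linear : linear form_counit.
Proof.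
move=> c x y; rewrite /form_counit -[RHS]scalar_partP scaler_sumr -big_split.
by congr scalar_part; apply: eq_bigr => n _; rewrite linearP.
Qed.

HB.instance Definition _ :=
  GRing.isLinear.Build k H k^o *:%R form_counit form_counit_linear.

Lemma form_counitE h : (form_counit h : k)%:A = \sum_n form_coef n h.
Proof.
rewrite scalar_partE // => g; rewrite rmorph_sum.
rewrite [RHS](reindex_inj (can_inj (galois_actK alpha g))).
by apply: eq_bigr => n _; rewrite /= form_coefJ.
Qed.

Definition form_antipode (h : H) : H :=
  form_of alpha (fun n => form_coef n^-1%g h).

HB.instance Definition _ := GRing.isLinear.Build k H H *:%R form_antipode
  (form_of_linear (fun n => form_coef n^-1%g)).

Lemma form_antipodeE n h : form_coef n (form_antipode h) = form_coef n^-1%g h.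
Proof. by rewrite form_ofE // => g m; rewrite form_coefJ galois_actV. Qed.

Let inj_algE : injective (fun c : k => c%:A : E).
Proof. exact: (fmorph_inj (in_alg E)). Qed.

Fact form_comul1 : form_comul 1 = tens 1 1.
Proof.
apply: form_pair_inj => m n; rewrite form_pair_comul form_pair_tens !form_coef1.
by case: eqVneq => [->|mn]; case: eqVneq => m1; rewrite ?mul1r ?mul0r //;
   case: eqVneq => n1 //; rewrite ?mulr0 //; case/eqP: mn; rewrite m1.
Qed.

Lemma form_coefMr n (x y : H) :
  form_coef n (x * y) = \sum_m form_coef (n * m^-1)%g x * form_coef m y.
Proof.
rewrite form_coefM (reindex_inj (mulgI n)) (reindex_inj invg_inj).
by apply: eq_bigr => m _ /=; rewrite invMg invgK mulgKV.
Qed.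

Fact form_comulM x y :
  form_comul (x * y) = tens_mul (form_comul x) (form_comul y).
Proof.
apply: form_pair_inj => m n; rewrite linear_tens_lift.
transitivity (tens_lift (fun a b => \sum_q form_coef (m * q^-1)%g a *
    form_coef (n * q^-1)%g b * form_coef q y) (form_comul x)); last first.
  apply: eq_tens_lift => a b; rewrite linear_tens_lift.
  rewrite -(form_tens_lift_comul
    (fun p q => form_coef (m * p^-1)%g a * form_coef (n * q^-1)%g b)).
  apply: eq_tens_lift => a' b'; rewrite [RHS]form_pair_tens !form_coefMr.
  rewrite big_distrlr; apply: eq_bigr => p _; apply: eq_bigr => q _.
  by rewrite mulrACA.
rewrite tens_lift_sum form_pair_comul form_coefMr mulr_sumr.
apply: eq_bigr => q _; rewrite tens_lift_mulr [tens_lift _ _]form_pair_comul.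
by rewrite (inj_eq (mulIg _)) mulrA.
Qed.

Fact form_counit1 : form_counit 1 = 1.
Proof.
apply: inj_algE; rewrite /= form_counitE scale1r (bigD1 1%g) //= form_coef1 eqxx.
by rewrite big1 ?addr0 // => n /negPf n1; rewrite form_coef1 n1.
Qed.

Fact form_counitM x y :
  form_counit (x * y) = (form_counit x : k) * (form_counit y : k).
Proof.
apply: inj_algE; rewrite /= -[RHS]scalerA -[RHS]mulr_algl !form_counitE.
under eq_bigr do rewrite form_coefMr.
rewrite exchange_big mulr_sumr; apply: eq_bigr => m _ /=.
rewrite (reindex_inj (mulIg m)) mulr_suml.
by apply: eq_bigr => n _; rewrite mulgK.
Qed.

Fact form_comulA x :
  tens_assoc (tens_map form_comul idfun (form_comul x)) =
  tens_map idfun form_comul (form_comul x).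
Proof.
(* On both sides the coefficient is that of [x] at [l] if [l], [m], [n] agree, and 0 otherwise. *)
apply: form_triple_inj => l m n.
transitivity (tens_form (form_pair l m) (form_coef n)
    (tens_map form_comul idfun (form_comul x))).
  rewrite [LHS]linear_tens_lift; apply: eq_tens_lift => uv w.
  rewrite linear_tens_lift -tens_lift_mulr; apply: eq_tens_lift => u v.
  by rewrite [LHS]tens_formE /= form_pair_tens mulrA.
rewrite !linear_tens_lift.
transitivity ((l == m)%:R * form_pair l n (form_comul x)).
  rewrite -tens_lift_mull; apply: eq_tens_lift => u v.
  by rewrite [LHS]tens_formE /= form_pair_comul mulrA.
transitivity ((m == n)%:R * form_pair l m (form_comul x)); last first.
  rewrite -tens_lift_mull; apply: eq_tens_lift => u v.
  by rewrite [RHS]tens_formE /= form_pair_comul mulrCA.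
rewrite !form_pair_comul !mulrA -!natrM !mulnb; congr ((nat_of_bool _)%:R * _).
by case: eqVneq => [->|]; rewrite ?andbT ?andbF.
Qed.

Fact form_counitl x :
  tens_lift (fun a b => form_counit a *: b) (form_comul x) = x.
Proof.
apply: form_coefP => n; rewrite linear_tens_lift.
transitivity (tens_lift (fun a b => \sum_m form_coef m a * form_coef n b)
  (form_comul x)).
  apply: eq_tens_lift => a b.
  by rewrite linearZ /= -mulr_algl form_counitE mulr_suml.
rewrite tens_lift_sum (bigD1 n) //= [tens_lift _ _]form_pair_comul eqxx mul1r.
rewrite big1 ?addr0 // => m /negPf mn.
by rewrite [LHS]form_pair_comul mn mul0r.
Qed.

Fact form_counitr x :
  tens_lift (fun a b => form_counit b *: a) (form_comul x) = x.
Proof.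
apply: form_coefP => n; rewrite linear_tens_lift.
transitivity (tens_lift (fun a b => \sum_m form_coef n a * form_coef m b)
  (form_comul x)).
  apply: eq_tens_lift => a b.
  by rewrite linearZ /= -mulr_algl form_counitE mulrC mulr_sumr.
rewrite tens_lift_sum (bigD1 n) //= [tens_lift _ _]form_pair_comul eqxx mul1r.
rewrite big1 ?addr0 // => m /negPf mn.
by rewrite [LHS]form_pair_comul eq_sym mn mul0r.
Qed.

Fact form_antipodel x :
  tens_lift (fun a b => form_antipode a * b) (form_comul x) =
  (form_counit x : k)%:A.
Proof.
apply: form_coefP => n; rewrite linear_tens_lift.
transitivity (tens_lift (fun a b => \sum_m form_coef m^-1%g a *
    form_coef (m^-1 * n)%g b) (form_comul x)).
  apply: eq_tens_lift => a b; rewrite [LHS]form_coefM.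
  by apply: eq_bigr => m _; rewrite form_antipodeE.
rewrite tens_lift_sum linearZ /= -mulr_algl form_counitE form_coef1 mulr_suml.
rewrite [RHS](reindex_inj invg_inj); apply: eq_bigr => m _.
rewrite [LHS]form_pair_comul mulrC; congr (_ * (nat_of_bool _)%:R).
by rewrite -[X in X == _]mulg1 (inj_eq (mulgI _)) eq_sym.
Qed.

Fact form_antipoder x :
  tens_lift (fun a b => a * form_antipode b) (form_comul x) =
  (form_counit x : k)%:A.
Proof.
apply: form_coefP => n; rewrite linear_tens_lift.
transitivity (tens_lift (fun a b => \sum_m form_coef (n * m^-1)%g a *
    form_coef m^-1%g b) (form_comul x)).
  apply: eq_tens_lift => a b; rewrite [LHS]form_coefMr.
  by apply: eq_bigr => m _; rewrite form_antipodeE.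
rewrite tens_lift_sum linearZ /= -mulr_algl form_counitE form_coef1 mulr_suml.
rewrite [RHS](reindex_inj (mulgI n)) [RHS](reindex_inj invg_inj).
apply: eq_bigr => m _.
rewrite [LHS]form_pair_comul mulrC; congr (_ * (nat_of_bool _)%:R).
by rewrite -[X in _ == X]mul1g (inj_eq (mulIg _)).
Qed.

Definition form_hopf_algebra : hopf_algebra k :=
  HopfAlgebra form_comul1 form_comulM form_counit1 form_counitM form_comulA
    form_counitl form_counitr form_antipodel form_antipoder.

Lemma form_hopf_cocommutative : cocommutative form_hopf_algebra.
Proof.
move=> x; apply: form_pair_inj => m n; rewrite linear_tens_lift.
transitivity (form_pair n m (form_comul x)).
  by apply: eq_tens_lift => a b; rewrite [LHS]form_pair_tens mulrC.
rewrite !form_pair_comul eq_sym.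
by case: eqVneq => [->|]; rewrite ?mul0r.
Qed.

End FormHopfAlgebra.

(** * Hopf Galois structures *)

Section FormHopfGalois.
Variables (k : fieldType) (E : splittingFieldType k) (nT : finGroupType).
Variables (alpha : galois_action E nT) (galE : galois 1 {:E}).
Local Notation gT := (gal_of {:E}).
Local Notation H := (subvs_of (galois_form alpha)).
Variables (F : {subfield E}) (sigma : nT -> gT).
Local Notation L := (subvs_of F).
Local Notation U := 'Gal({:E} / F)%G.

Hypothesis sigma1 : sigma 1%g = 1%g.
(* As the product of gal_of composes its left factor first, this makes
   h |-> \sum_n h_n sigma_n multiplicative on equivariant families (h_n). *)
Hypothesis sigmaM : forall m n,
  (sigma m * sigma n)%g = sigma (n * alpha (sigma n) m)%g.
Hypothesis sigmaJ : forall u n, u \in U -> (sigma n ^ u)%g = sigma (alpha u n).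
Hypothesis sigma_inj : forall m n, (sigma m * (sigma n)^-1)%g \in U -> m = n.
Hypothesis card_nT : #|nT| = \dim F.

Definition form_act_val (h : H) (t : L) : E :=
  \sum_n form_coef n h * sigma n (vsval t).

(** By [sigmaJ] an element of [U] permutes the summands, so the value is fixed by [U]. *)
Lemma form_act_val_mem h t : form_act_val h t \in F.
Proof.
have galF : galois F {:E} by apply: galoisS galE; rewrite sub1v subvf.
rewrite -(galois_fixedField galF); apply/fixedFieldP; rewrite ?memvf // => u Uu.
rewrite rmorph_sum [RHS](reindex_inj (can_inj (galois_actK alpha u))).
apply: eq_bigr => n _; rewrite rmorphM /= form_coefJ -sigmaJ //.
congr (_ * _); rewrite -galM ?memvf // conjgC galM ?memvf //.
by rewrite (fixed_gal (subvf F) Uu (subvsP t)).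
Qed.

Definition form_act_fun (h : H) (t : L) : L := vsproj F (form_act_val h t).

Lemma form_act_funE h t : vsval (form_act_fun h t) = form_act_val h t.
Proof. by rewrite vsprojK ?form_act_val_mem. Qed.

Fact form_act_fun_linear h : linear (form_act_fun h).
Proof.
move=> c s t; apply: subvs_inj; rewrite [RHS]linearP /= !form_act_funE.
rewrite scaler_sumr -big_split; apply: eq_bigr => n _ /=.
by rewrite !linearP /= mulrDr -scalerAr.
Qed.

HB.instance Definition _ h :=
  GRing.isLinear.Build k L L *:%R (form_act_fun h) (form_act_fun_linear h).

Definition form_act (h : H) : 'End(L) := linfun (form_act_fun h).

Lemma form_actE h t : vsval (form_act h t) = form_act_val h t.
Proof. by rewrite lfunE /= form_act_funE. Qed.

Fact form_act_linear : linear form_act.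
Proof.
move=> c x y; apply/lfunP=> t; apply: subvs_inj.
rewrite /= form_actE add_lfunE scale_lfunE linearP /= !form_actE.
rewrite scaler_sumr -big_split; apply: eq_bigr => n _ /=.
by rewrite linearP mulrDl -scalerAl.
Qed.

HB.instance Definition _ :=
  GRing.isLinear.Build k H 'End(L) *:%R form_act form_act_linear.

Fact form_act1 t : form_act 1 t = t.
Proof.
apply: subvs_inj; rewrite /= form_actE /form_act_val (bigD1 1%g) //=.
rewrite form_coef1 eqxx mul1r sigma1 gal_id big1 ?addr0 // => n /negPf n1.
by rewrite form_coef1 n1 mul0r.
Qed.

Fact form_actM g h t : form_act (g * h) t = form_act g (form_act h t).
Proof.
apply: subvs_inj; rewrite /= !form_actE /form_act_val form_actE.
under [RHS]eq_bigr do rewrite rmorph_sum mulr_sumr.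
under [LHS]eq_bigr do rewrite form_coefM mulr_suml.
rewrite exchange_big; apply: eq_bigr => n _ /=.
(* The inner index becomes [n * alpha (sigma n) m]: [form_coefJ] moves the coefficients of [h] this
   way, and [sigmaM] has this form. *)
rewrite (reindex_inj (mulgI n)).
rewrite (reindex_inj (can_inj (galois_actK alpha (sigma n)))) /=.
apply: eq_bigr => m _; rewrite rmorphM /= form_coefJ mulKg -mulrA.
by rewrite -sigmaM galM ?memvf.
Qed.

Fact form_act_one h : form_act h 1 = (form_counit h : k)%:A.
Proof.
have vsval1 : vsval (1 : L) = 1 by rewrite /= algid1.
apply: subvs_inj; rewrite form_actE; transitivity ((form_counit h : k)%:A : E).
  rewrite (form_counitE galE) /form_act_val vsval1; apply: eq_bigr => n _.
  by rewrite rmorph1 mulr1.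
by rewrite [RHS]linearZ /= algid1.
Qed.

Fact form_act_mul h s t :
  form_act h (s * t) =
  tens_lift (fun a b => form_act a s * form_act b t) (form_comul h).
Proof.
apply: subvs_inj; rewrite linear_tens_lift form_actE.
transitivity (tens_lift (fun a b => \sum_m \sum_n
    (sigma m (vsval s) * sigma n (vsval t)) * (form_coef m a * form_coef n b))
  (form_comul h)).
  rewrite form_tens_lift_comul //; apply: eq_bigr => n _.
  by rewrite rmorphM mulrC.
apply: eq_tens_lift => a b; rewrite [RHS]/= !form_actE big_distrlr.
apply: eq_bigr => m _; apply: eq_bigr => n _ /=.
by rewrite mulrACA; congr (_ * _); rewrite mulrC.
Qed.

(* Dedekind independence on E, applied to traces from E to F. *)
Lemma sigma_free (c : nT -> E) :
  (forall t : L, \sum_n c n * sigma n (vsval t) = 0) -> forall n, c n = 0.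
Proof.
move=> sum0 n.
pose d (g : gT) := \sum_(m | (g * (sigma m)^-1)%g \in U) c m.
have <-: d (sigma n) = c n.
  rewrite /d (bigD1 n) ?mulgV ?group1 //= big1 ?addr0 // => m /andP[Um].
  by rewrite (sigma_inj Um) eqxx.
apply: (gal_sum_eq0 (c := d)) => a.
have galF : galois F {:E} by apply: galoisS galE; rewrite sub1v subvf.
have Ftr := mem_galTrace galF (memvf a).
rewrite -[RHS](sum0 (Subvs Ftr)) /= /galTrace.
under [RHS]eq_bigr do rewrite rmorph_sum mulr_sumr.
under eq_bigr do rewrite mulr_suml.
rewrite (exchange_big_dep predT) //=; apply: eq_bigr => m _.
rewrite (reindex_inj (mulIg (sigma m))) /=.
apply: eq_big => [u | u _]; first by rewrite mulgK.
by rewrite galM ?memvf.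
Qed.

Local Notation HA := (form_hopf_algebra alpha galE).

Definition form_galois_map : tensor L H -> 'End(L) :=
  hopf_galois_map (H := HA) form_act.

HB.instance Definition _ := GRing.isLinear.Build k (tensor L H) 'End(L) *:%R
  form_galois_map
  (tens_lift_linear (fun (s : L) (h : H) => (amull s \o form_act h)%VF)).

(** A kernel element gives a relation between the [sigma n] on [L]. By [sigma_free] its coefficients
    vanish, which is an [E]-relation between basis elements of [H], excluded by
    [form_basis_free]. *)
Lemma form_galois_map_inj : injective form_galois_map.
Proof.
apply: raddf_inj => x jx0; apply/matrixP=> i m; rewrite mxE.
apply: (freeP (basis_free (vbasisP {:L})) (fun i => x i m)).
apply: subvs_inj; rewrite linear0 linear_sum /=.
apply: (form_basis_free galE
  (v := fun m => \sum_i vsval (x i m *: (vbasis {:L})`_i))) => n.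
move: n; apply: sigma_free => t.
have := congr1 (fun f : 'End(L) => vsval (f t)) jx0.
rewrite zero_lfunE /= sum_lfunE linear_sum => jxt.
rewrite -[RHS]jxt.
transitivity (\sum_j (\sum_i vsval (x i j *: (vbasis {:L})`_i)) *
    form_act_val (vbasis {:H})`_j t).
  under eq_bigr do rewrite mulr_suml.
  rewrite exchange_big; apply: eq_bigr => j _; rewrite [RHS]mulr_sumr.
  by apply: eq_bigr => n _; rewrite [RHS]mulrA.
under eq_bigr do rewrite mulr_suml.
rewrite exchange_big; apply: eq_bigr => l _ /=; rewrite sum_lfunE linear_sum.
apply: eq_bigr => j _; rewrite scale_lfunE comp_lfunE lfunE [RHS]linearZ /=.
by rewrite form_actE scalerAl.
Qed.

(** Injectivity suffices, both dimensions being the square of that of [L]. *)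
Fact form_galois_map_bij : bijective form_galois_map.
Proof.
have ker0 : lker (linfun form_galois_map) == 0%VS.
  by apply/lker0P => x y; rewrite !lfunE; apply: form_galois_map_inj.
have im_j : limg (linfun form_galois_map) = fullv.
  apply/eqP; rewrite eqEdim subvf limg_dim_eq ?(eqP ker0) ?capv0 //.
  have dimL : \dim {:L} = \dim F by rewrite dimvf.
  have -> : \dim {:'End(L)} = (\dim {:L} * \dim {:L})%N.
    by rewrite !dimvf.
  have -> : \dim {:tensor L H} = (\dim {:L} * \dim {:H})%N.
    by rewrite dimvf dim_matrix.
  by rewrite dim_form // card_nT dimL /=.
exists (linfun form_galois_map)^-1%VF => [x | f].
  by rewrite -(lfunE form_galois_map) lker0_lfunK.
by rewrite -(lfunE form_galois_map) limg_lfunVK // im_j memvf.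
Qed.

Definition form_hopf_galois_structure : hopf_galois_structure L :=
  @HopfGaloisStructure k L HA form_act (@form_hopf_cocommutative _ _ _ alpha galE)
    form_act1 form_actM form_act_one form_act_mul form_galois_map_bij.

End FormHopfGalois.

(** * Two Hopf Galois structures from a normal complement *)

Section NormalComplement.
Variables (k : fieldType) (E : splittingFieldType k) (galE : galois 1 {:E}).
Local Notation gT := (gal_of {:E}).
Variables (F : {subfield E}) (N : {group gT}).
Local Notation L := (subvs_of F).
Local Notation U := 'Gal({:E} / F)%G.
Hypothesis sdNU : (N ><| U)%g = [set: gT].

Let nsN : N <| [set: gT]. Proof. by case/sdprod_context: sdNU. Qed.
Let tiNU : N :&: U = 1%g. Proof. by case/sdprod_context: sdNU. Qed.
Let defG : (N * U)%g = [set: gT]. Proof. exact: sdprodW sdNU. Qed.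
Let complU : U \in [complements to N in [set: gT]].
Proof. by rewrite sdprod_compl. Qed.

Let galF : galois F {:E}.
Proof. by apply: galoisS galE; rewrite sub1v subvf. Qed.

Let sub_inj m n : m \in N -> n \in N -> (m * n^-1)%g \in U -> m = n.
Proof.
move=> Nm Nn Umn; apply/eqP; rewrite eq_mulgV1 -in_set1 -set1gE -tiNU.
by rewrite inE groupM ?groupV.
Qed.

Let card_subg : #|{: [subg N]}| = \dim F.
Proof.
have galT : 'Gal({:E} / 1)%g = [set: gT].
  apply/setP=> g; rewrite inE gal_kAut ?sub1v // kAutfE k1HomE.
  exact: valP (gal_repr g).
have dimE : #|[set: gT]| = \dim {:E}.
  by rewrite -galT -(galois_dim galE) dimv1 divn1.
have dimNU : (#|N| * #|U|)%N = \dim {:E} := etrans (sdprod_card sdNU) dimE.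
rewrite card_sub; apply/eqP; rewrite -(eqn_pmul2r (cardG_gt0 U)) dimNU.
by rewrite -(galois_dim galF) mulnC -dim_sup_field ?subvf.
Qed.

Let mem_sgvalJ (n : [subg N]) g : (sgval n ^ g)%g \in N.
Proof. by rewrite memJ_norm ?subgP ?(subsetP (normal_norm nsN)) ?inE. Qed.

Definition conj_act (g : gT) (n : [subg N]) : [subg N] := subg N (sgval n ^ g).

Fact conj_act1 n : conj_act 1%g n = n.
Proof. by rewrite /conj_act conjg1 sgvalK. Qed.
Fact conj_actJ g h n : conj_act (g * h)%g n = conj_act h (conj_act g n).
Proof. by rewrite /conj_act [in RHS]subgK // conjgM. Qed.
Fact conj_actM g m n : conj_act g (m * n)%g = (conj_act g m * conj_act g n)%g.
Proof. by rewrite -morphM //= -conjMg. Qed.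

Definition conj_action := GaloisAction conj_act1 conj_actJ conj_actM.

(** Here [remgr N U g] is the factor of [g] in [U], so [N] acts trivially. *)
Definition twisted_act (g : gT) := conj_act (remgr N U g).

Fact twisted_act1 n : twisted_act 1%g n = n.
Proof. by rewrite /twisted_act remgr1 ?group1 // conj_act1. Qed.
Fact twisted_actJ g h n :
  twisted_act (g * h)%g n = twisted_act h (twisted_act g n).
Proof. by rewrite /twisted_act (remgrM complU nsN) ?inE // conj_actJ. Qed.
Fact twisted_actM g m n :
  twisted_act g (m * n)%g = (twisted_act g m * twisted_act g n)%g.
Proof. exact: conj_actM. Qed.

Definition twisted_action := GaloisAction twisted_act1 twisted_actJ twisted_actM.

Let conj_inj (m n : [subg N]) : (sgval m * (sgval n)^-1)%g \in U -> m = n.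
Proof. by move=> Umn; apply/val_inj/sub_inj; rewrite ?subgP. Qed.

Let conj_sigmaJ u (n : [subg N]) :
  u \in U -> (sgval n ^ u)%g = sgval (conj_action u n).
Proof. by rewrite /= subgK. Qed.

Let twisted_sigmaJ u (n : [subg N]) :
  u \in U -> ((sgval n)^-1 ^ u)%g = (sgval (twisted_action u n))^-1%g.
Proof.
by move=> Uu; rewrite /= /twisted_act (remgr_id tiNU) // subgK // conjVg.
Qed.

Definition conj_structure : hopf_galois_structure L.
Proof.
refine (@form_hopf_galois_structure k E (subg_of N) conj_action galE F
  (@sgval _ N) _ _ _ _ _) => //.
- by move=> m n; rewrite /= subgK // -conjgC.
Defined.

(** Since [N] acts trivially on itself, [sigmaM] asks for a map that reverses products; hence the
    inverse. *)
Definition twisted_structure : hopf_galois_structure L.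
Proof.
refine (@form_hopf_galois_structure k E (subg_of N) twisted_action galE F
  (fun n => (sgval n)^-1%g) _ _ _ _ _) => //.
- exact: invg1.
- move=> m n; rewrite /= /twisted_act remgr1 ?groupV ?subgP //.
  by rewrite conj_act1 invMg.
- move=> m n Umn; apply/val_inj/invg_inj/sub_inj; rewrite ?groupV ?subgP //.
Defined.

(** As [c] commutes with [U], the group element [c^-1] is fixed under the twisted action and acts on
    [L] as [c]. An isomorphism would yield an [x] in the other Hopf algebra with the same action,
    which forces [x] to be the group element [c]; its invariance under conjugation makes [c]
    central. *)
Lemma normal_complement_structures (c : gT) :
  c \in N -> c \in 'C(U) -> c \notin 'C([set: gT]) ->
  ~ hgs_isomorphic conj_structure twisted_structure.
Proof.
move=> Nc cUc /negP ncGc [f [[f' fK f'K] _ _ _ actf]]; apply: ncGc.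
pose d (n : [subg N]) : E := (n == subg N c^-1)%:R.
have dJ (g : gT) n : g (d n) = d (twisted_act g n).
  rewrite rmorph_nat /d; congr (nat_of_bool _)%:R.
  rewrite -(inj_eq (can_inj (galois_actK twisted_action g))) /=.
  congr (_ == _); rewrite /twisted_act /conj_act subgK ?groupV //.
  have Ug : remgr N U g \in U by rewrite mem_remgr // defG inE.
  by rewrite conjVg (conjg_fixP _) //; apply/commgP/(centP cUc).
pose h : twisted_structure := form_of twisted_action d.
have fx := f'K h; move: (f' h) fx => x fx.
(* Independence of the elements of [N] on [L] determines the coefficients of [x] from its action. *)
have coefx n : form_coef n x = (n == subg N c)%:R.
  apply/eqP; rewrite -subr_eq0; apply/eqP; move: n.
  apply: (sigma_free galE conj_inj) => t.
  have /(congr1 vsval) := actf x t; rewrite fx (form_actE galE twisted_sigmaJ)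
    (form_actE galE conj_sigmaJ) /form_act_val.
  rewrite (bigD1 (subg N c^-1)) //= form_ofE // /d eqxx mul1r.
  rewrite big1 => [|n nc]; last by rewrite form_ofE // /d (negPf nc) mul0r.
  rewrite addr0 subgK ?groupV // invgK => ct.
  under eq_bigr do rewrite mulrBl.
  rewrite sumrB -ct (bigD1 (subg N c)) //= eqxx mul1r subgK //.
  by rewrite big1 ?addr0 ?subrr // => n /negPf->; rewrite mul0r.
apply/centP => g _.
have := form_coefJ g (subg N c) x.
rewrite !coefx eqxx rmorph1.
case: eqP => [|_ /eqP]; last by rewrite oner_eq0.
move=> /(congr1 (@sgval _ N)); rewrite subgK ?mem_sgvalJ // subgK // => cg _.
exact/commgP/conjg_fixP.
Qed.

End NormalComplement.

(** * From a Hopf Galois structure to a regular group *)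

Section HopfGaloisRegular.
Variables (k : fieldType) (E : splittingFieldType k).
Variable F : {subfield E}.
Local Notation gT := (gal_of {:E}).
Local Notation L := (subvs_of F).
Local Notation U := 'Gal({:E} / F)%G.
Variable S : hopf_galois_structure L.
Local Notation H := (hgs_alg S).
Local Notation act := (hgs_act S).
Local Notation d := (\dim {:H}).
Local Notation h p := (vbasis {:H})`_p.
Implicit Types (e : 'I_d -> E) (g : gT) (t : L).

(** This identifies the points of the coset space with the [k]-embeddings of [F] into [E]. *)
Lemma gal_coset_eq g g' :
  coset_pt U g = coset_pt U g' <-> forall t, g (vsval t) = g' (vsval t).
Proof.
split=> [/coset_ptP Ugg' t | eqgg'].
  rewrite -{1}[g](mulgKV g') galM ?memvf //.
  by rewrite (fixed_gal (subvf F) Ugg' (subvsP t)).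
apply/coset_ptP; rewrite gal_kHom ?subvf //; apply/andP; split.
  exact: valP (gal_repr _).
apply/subvP=> a Fa; apply/fixedSpaceP.
rewrite galM ?memvf // -[a](vsprojK Fa) eqgg' -galM ?memvf // mulgV.
by rewrite gal_id.
Qed.

Lemma hopf_galois_mapE x t :
  hopf_galois_map act x t =
  \sum_p (\sum_i x i p *: (vbasis {:L})`_i) * act (vbasis {:H})`_p t.
Proof.
rewrite /hopf_galois_map /tens_lift sum_lfunE.
under eq_bigr do rewrite sum_lfunE.
rewrite exchange_big; apply: eq_bigr => p _; rewrite mulr_suml.
apply: eq_bigr => i _; rewrite scale_lfunE comp_lfunE lfunE /=.
by rewrite scalerAl.
Qed.

Lemma act_free (v : 'I_d -> L) :
  (forall t, \sum_p v p * act (vbasis {:H})`_p t = 0) -> forall p, v p = 0.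
Proof.
move=> sum0 p.
pose x : tensor L H := \matrix_(i, p) coord (vbasis {:L}) i (v p).
have sumx q : \sum_i x i q *: (vbasis {:L})`_i = v q.
  rewrite [RHS](coord_vbasis (memvf (v q))).
  by apply: eq_bigr => i _; rewrite mxE.
have x0 : x = 0.
  apply: (bij_inj (hgs_bij S)); apply/lfunP=> t; rewrite !hopf_galois_mapE.
  under eq_bigr do rewrite sumx.
  rewrite sum0 big1 // => q _; rewrite big1 ?mul0r // => i _.
  by rewrite mxE scale0r.
by rewrite -sumx x0 big1 // => i _; rewrite mxE scale0r.
Qed.

(** Surjectivity of j, applied to the coordinate functionals of [L]. *)
Lemma act_dual : exists B : 'I_(\dim {:L}) -> 'I_d -> L, forall l t,
  \sum_p B l p * act (vbasis {:H})`_p t = (coord (vbasis {:L}) l t)%:A.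
Proof.
have [j' _ jK] := hgs_bij S.
have lin_delta l : linear (fun t : L => (coord (vbasis {:L}) l t)%:A : L).
  by move=> c x y; rewrite linearP scalerDl -scalerA.
pose deltaM l := GRing.isLinear.Build k L L *:%R _ (lin_delta l).
pose delta l : {linear L -> L} := 
  HB.pack (fun t : L => (coord (vbasis {:L}) l t)%:A : L) (deltaM l).
exists (fun l p => \sum_i j' (linfun (delta l)) i p *: (vbasis {:L})`_i) => l t.
by rewrite -hopf_galois_mapE jK lfunE.
Qed.

(** The family [e] holds the coordinates of an element of E ⊗ H, here applied to the embedding
    [g]. *)
Definition twisted_sum e g t : E := \sum_i e i * g (vsval (act (h i) t)).

(** The matrix of the values of the [h p] on a basis has free rows over [L] by [act_free], and the
    field morphism [g] preserves this. *)
Lemma twisted_sum_free e g : (forall t, twisted_sum e g t = 0) -> forall i, e i = 0.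
Proof.
move=> sum0 i.
pose M : 'M[L]_(d, \dim {:L}) := \matrix_(p, m) act (h p) (vbasis {:L})`_m.
have freeM : row_free M.
  rewrite -kermx_eq0; apply/rowV0P => v /sub_kermxP vM0.
  apply/rowP=> p; rewrite mxE; apply: (act_free (v := v 0)) => t.
  rewrite [t](coord_vbasis (memvf t)).
  under eq_bigr do rewrite linear_sum mulr_sumr.
  rewrite exchange_big big1 // => m _.
  have /rowP/(_ m) := vM0; rewrite !mxE => vMm.
  rewrite -[RHS](scaler0 _ (coord (vbasis {:L}) m t)) -[in RHS]vMm scaler_sumr.
  by apply: eq_bigr => q _; rewrite mxE linearZ scalerAr.
pose f : {rmorphism L -> E} := gal_repr g \o vsval.
have freefM : row_free (map_mx f M) by rewrite row_free_map.
have: \row_i e i *m map_mx f M = 0 *m map_mx f M.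
  rewrite mul0mx; apply/rowP=> m; rewrite !mxE -[RHS](sum0 (vbasis {:L})`_m).
  by apply: eq_bigr => p _; rewrite !mxE.
by move/(row_free_inj freefM)/rowP/(_ i); rewrite !mxE.
Qed.

(** The embedding [g'] is a combination of coordinate functionals, with its values on the basis as
    weights; [act_dual] expresses each functional through the [h p], and [g] carries this over. *)
Lemma twisted_sum_span g g' : exists e, forall t, twisted_sum e g t = g' (vsval t).
Proof.
have [B DB] := act_dual.
exists (fun p => \sum_(l < \dim {:L})
  g' (vsval (vbasis {:L})`_l) * g (vsval (B l p))) => t.
transitivity (\sum_(l < \dim {:L}) g' (vsval (vbasis {:L})`_l) *
    g (vsval (\sum_p B l p * act (h p) t))).
  under [RHS]eq_bigr do rewrite !rmorph_sum mulr_sumr.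
  rewrite [RHS]exchange_big; apply: eq_bigr => p _; rewrite mulr_suml.
  by apply: eq_bigr => l _; rewrite !rmorphM mulrA.
rewrite [in RHS](coord_vbasis (memvf t)) !linear_sum; apply: eq_bigr => l _.
by rewrite DB !linearZ /= algid1 rmorph1 mulr_algr.
Qed.

(** The conditions Δ(e) = e ⊗ e and ε(e) = 1 in E ⊗ H, in coordinates. *)
Definition grouplike e :=
  (forall p q, \sum_i e i * (comul (h i) p q)%:A = e p * e q) /\
  \sum_i e i * (counit (h i) : k)%:A = 1.

Lemma twisted_sumM e g s t :
  twisted_sum e g (s * t) =
  \sum_p \sum_q (\sum_i e i * (comul (h i) p q)%:A) *
    (g (vsval (act (h p) s)) * g (vsval (act (h q) t))).
Proof.
under [RHS]eq_bigr do under eq_bigr do rewrite mulr_suml.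
under [RHS]eq_bigr do rewrite exchange_big.
rewrite [RHS]exchange_big; apply: eq_bigr => i _.
rewrite hgs_act_mul /tens_lift !linear_sum mulr_sumr; apply: eq_bigr => p _.
rewrite !linear_sum mulr_sumr; apply: eq_bigr => q _.
rewrite !linearZ /= rmorphM -mulrA; congr (_ * _).
by rewrite mulr_algl.
Qed.

Lemma twisted_sum1 e g : twisted_sum e g 1 = \sum_i e i * (counit (h i) : k)%:A.
Proof.
apply: eq_bigr => i _; rewrite hgs_act_one !linearZ /= algid1 rmorph1.
by [].
Qed.

(** Since [g'] is multiplicative, Δ(e) - e ⊗ e vanishes on all pairs [s], [t]; freeness in each
    variable shows that it is zero. *)
Lemma twisted_sum_grouplike e g g' :
  (forall t, twisted_sum e g t = g' (vsval t)) -> grouplike e.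
Proof.
move=> eg; split; last first.
  by rewrite -(twisted_sum1 e g) eg /= algid1 rmorph1.
suff D0 p q : \sum_i e i * (comul (h i) p q)%:A - e p * e q = 0.
  by move=> p q; apply/eqP; rewrite -subr_eq0 D0.
pose D p q : E := \sum_i e i * (comul (h i) p q)%:A - e p * e q.
apply: (twisted_sum_free (e := D p) (g := g)) => t; move: p.
apply: (twisted_sum_free (g := g)) => s.
transitivity (twisted_sum e g (s * t) - twisted_sum e g s * twisted_sum e g t).
  rewrite twisted_sumM big_distrlr -sumrB; apply: eq_bigr => p _ /=.
  rewrite -sumrB mulr_suml; apply: eq_bigr => q' _.
  rewrite [X in _ = _ - X]mulrACA -mulrBl -mulrA; congr (_ * _).
  exact: mulrC.
by rewrite !eg /= rmorphM subrr.
Qed.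

(** The twisted sum is then a [k]-algebra morphism on [F], and it extends to an automorphism because
    [E] is normal. *)
Lemma grouplike_gal e g : grouplike e ->
  exists g' : gT, forall t, twisted_sum e g t = g' (vsval t).
Proof.
case=> eM e1.
have lin_f : linear (fun x : E => twisted_sum e g (vsproj F x) : E).
  move=> c x y; rewrite linearP /twisted_sum scaler_sumr -big_split.
  by apply: eq_bigr => i _; rewrite !linearP mulrDr scalerAr.
pose fM := GRing.isLinear.Build k E E *:%R _ lin_f.
pose f : {linear E -> E} :=
  HB.pack (fun x : E => twisted_sum e g (vsproj F x) : E) fM.
have fE t : linfun f (vsval t) = twisted_sum e g t by rewrite lfunE /= vsvalK.
have homf : kHom 1 F (linfun f).
  rewrite k1HomE; apply/ahom_inP; split; last first.
    have -> : 1 = vsval (1 : L) by rewrite /= algid1.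
    by rewrite fE twisted_sum1 e1 /= algid1.
  move=> a b Fa Fb; rewrite -(vsprojK Fa) -(vsprojK Fb).
  move: (vsproj F a) (vsproj F b) => s t.
  rewrite -[vsval s * vsval t]/(vsval (s * t)) !fE twisted_sumM big_distrlr.
  apply: eq_bigr => p _; apply: eq_bigr => q _.
  by rewrite eM mulrACA.
have /kHom_to_gal : (1 <= F <= {:E})%VS by rewrite sub1v subvf.
case/(_ (linfun f) (normalFieldf 1) homf) => g' _ fg'; exists g' => t.
by rewrite -fE fg' ?subvsP.
Qed.

(** The witness is the product of [e] and [e'] in E ⊗ H. *)
Lemma twisted_sum_comp e e' : exists e'', forall g g',
  (forall t, twisted_sum e g t = g' (vsval t)) ->
  forall t, twisted_sum e'' g t = twisted_sum e' g' t.
Proof.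
exists (fun l => \sum_j \sum_i
  e' j * e i * (coord (vbasis {:H}) l (h i * h j))%:A) => g g' eg t.
transitivity (\sum_j e' j * (\sum_i e i * g (vsval (act (h i * h j) t)))).
  under [LHS]eq_bigr do rewrite mulr_suml.
  rewrite [LHS]exchange_big; apply: eq_bigr => j _; rewrite mulr_sumr.
  under eq_bigr do rewrite mulr_suml.
  rewrite exchange_big; apply: eq_bigr => i _ /=.
  rewrite [in RHS](coord_vbasis (memvf (h i * h j))) linear_sum sum_lfunE.
  rewrite !linear_sum !mulr_sumr; apply: eq_bigr => l _.
  by rewrite linearZ scale_lfunE !linearZ /= -!mulrA mulr_algl.
apply: eq_bigr => j _; rewrite -eg; congr (_ * _).
by apply: eq_bigr => i _; rewrite hgs_actM.
Qed.

Lemma twisted_sum_unit : exists e, forall g t, twisted_sum e g t = g (vsval t).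
Proof.
exists (fun l => (coord (vbasis {:H}) l 1)%:A) => g t.
rewrite -{2}[t](hgs_act1 S) [in RHS](coord_vbasis (memvf 1)).
rewrite linear_sum sum_lfunE !linear_sum; apply: eq_bigr => l _.
by rewrite linearZ scale_lfunE !linearZ /= mulr_algl.
Qed.

Lemma twisted_sum_gal e g g' (x : gT) :
  (forall t, twisted_sum e g t = g' (vsval t)) ->
  forall t, twisted_sum (fun i => x (e i)) (g * x)%g t = (g' * x)%g (vsval t).
Proof.
move=> eg t; rewrite galM ?memvf // -eg rmorph_sum.
by apply: eq_bigr => i _; rewrite rmorphM galM ?memvf.
Qed.

Lemma twisted_sum_inj e e' g :
  (forall t, twisted_sum e g t = twisted_sum e' g t) -> forall i, e i = e' i.
Proof.
move=> eqee' i; apply/eqP; rewrite -subr_eq0; apply/eqP; move: i.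
apply: (twisted_sum_free (e := fun i => e i - e' i) (g := g)) => t.
rewrite -[RHS](subrr (twisted_sum e' g t)) -[X in _ = X - _]eqee' -sumrB.
by apply: eq_bigr => i _; rewrite mulrBl.
Qed.

Local Notation X := (coset_space U).

(** For each [y] a unique [e y] moves [x0] to [y]. It is grouplike, so it moves every [x] to some
    point [f y x]; the [f y] form the group. An element of E ⊗ H is determined by its effect on one
    embedding, which gives semiregularity and closure under products and conjugation. *)
Theorem hopf_galois_regular : exists N : {group {perm X}},
  [/\ forall x y, exists2 p, p \in N & p x = y,
      forall p x, p \in N -> p x = x -> p = 1%g
    & forall g, coset_perm U g \in 'N(N)].
Proof.
pose r : X -> gT := @coset_pt_repr _ _.
pose moves e (x y : X) := forall t, twisted_sum e (r x) t = r y (vsval t).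
have moves_uniq e x y y' : moves e x y -> moves e x y' -> y = y'.
  move=> exy exy'; rewrite -(coset_pt_reprK y) -(coset_pt_reprK y').
  by apply/gal_coset_eq => t; rewrite -exy -exy'.
have rE g t : r (coset_pt U g) (vsval t) = g (vsval t).
  by move: t; apply/gal_coset_eq/coset_pt_reprK.
have movesP e g g' : (forall t, twisted_sum e g t = g' (vsval t)) ->
    moves e (coset_pt U g) (coset_pt U g').
  by move=> eg t; rewrite rE -eg; apply: eq_bigr => i _; rewrite rE.
pose x0 := coset_pt U 1%g.
have [e eP] := fin_all_exists (fun y => twisted_sum_span (r x0) (r y)).
have grouplike_ex e' x y : moves e' x y -> forall x', exists y', moves e' x' y'.
  move=> /twisted_sum_grouplike/grouplike_gal e'gal x'.
  have [g' e'g'] := e'gal (r x'); exists (coset_pt U g') => t.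
  by rewrite rE.
have [f0 f0P] := fin_all_exists (fun yx : X * X =>
  grouplike_ex (e yx.1) x0 yx.1 (eP yx.1) yx.2).
pose f y x := f0 (y, x).
have fP y x : moves (e y) x (f y x) by apply: (f0P (y, x)).
(* An element moving one point to a point is grouplike, so it moves [x0] to some [y] and equals
   [e y] by freeness. *)
have all_f e' x z : moves e' x z -> exists y, forall x', moves e' x' (f y x').
  move=> e'xz; have [y e'y] := grouplike_ex _ _ _ e'xz x0; exists y => x' t.
  rewrite -fP; apply: eq_bigr => i _; congr (_ * _); move: i.
  by apply: (twisted_sum_inj (g := r x0)) => t'; rewrite e'y eP.
have eq_f e' x z y : moves e' x z -> f y x = z -> forall x', moves e' x' (f y x').
  move=> e'xz fyx x' t; rewrite -fP; apply: eq_bigr => i _; congr (_ * _); move: i.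
  by apply: (twisted_sum_inj (g := r x)) => t'; rewrite e'xz -fyx fP.
have [e1 e1P] := twisted_sum_unit.
have f_id y x : f y x = x -> forall x', f y x' = x'.
  move=> fyx x'; have e1y := eq_f e1 x x y (fun t => e1P (r x) t) fyx.
  by apply: (moves_uniq e1 x') => // t; apply: e1P.
have f_comp y z : exists w, forall x, f w x = f z (f y x).
  have [e'' e''P] := twisted_sum_comp (e y) (e z).
  have e''m x : moves e'' x (f z (f y x)).
    by move=> t; rewrite (e''P _ _ (fP y x)) fP.
  have [w wP] := all_f _ _ _ (e''m x0); exists w => x.
  exact: moves_uniq (wP x) (e''m x).
have f_trans x y : exists z, f z x = y.
  have [e' e'xy] := twisted_sum_span (r x) (r y).
  have [z zP] := all_f e' x y e'xy; exists z.
  exact: moves_uniq (zP x) e'xy.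
(* Some [f z] undoes [f y] at [x0]; their composite fixes a point and so fixes all. *)
have f_inj y : injective (f y).
  have [z fz] := f_trans (f y x0) x0; have [w wE] := f_comp y z.
  apply: (can_inj (g := f z)) => x.
  by rewrite -wE; apply: (f_id w x0); rewrite wE.
pose N := [set perm (f_inj y) | y : X].
have groupN : group_set N.
  apply/group_setP; split.
    have [y fy] := f_trans x0 x0; apply/imsetP; exists y => //.
    by apply/permP=> x; rewrite perm1 permE (f_id y x0).
  move=> _ _ /imsetP[y _ ->] /imsetP[z _ ->].
  have [w wE] := f_comp y z; apply/imsetP; exists w => //.
  by apply/permP=> x; rewrite permM !permE wE.
exists (Group groupN); split.
- move=> x y; have [z fz] := f_trans x y.
  by exists (perm (f_inj z)); rewrite ?imset_f ?permE.
- move=> _ x /imsetP[y _ ->]; rewrite permE => /f_id fy.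
  by apply/permP=> x'; rewrite permE perm1 fy.
move=> g; rewrite inE; apply/subsetP=> _ /imsetP[_ /imsetP[y _ ->] ->].
(* Applying [g] to the coefficients of [e y] gives an element whose permutation is the conjugate by
   the translation of [g]. *)
pose e' i := g (e y i).
have e'P x : moves e' (coset_perm U g x) (coset_perm U g (f y x)).
  rewrite -{1}[x](coset_pt_reprK x) -(coset_pt_reprK (f y x)) !coset_permE.
  exact/movesP/twisted_sum_gal/fP.
have [z zP] := all_f _ _ _ (e'P x0); apply/imsetP; exists z => //.
apply/permP=> x; rewrite -[x](permKV (coset_perm U g)).
move: ((coset_perm U g)^-1%g x) => x'.
rewrite permJ (permE (f_inj y)) (permE (f_inj z)).
exact: moves_uniq (e'P x') (zP _).
Qed.

End HopfGaloisRegular.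

(** The fixed field of the core of Gal(E/K) is Galois over [k] and contains [K]; by minimality it is
    [E], so the core is trivial. *)
Lemma galois_closure_core (k : fieldType) (E : splittingFieldType k)
    (K : {subfield E}) : is_galois_closure K {:E}%AS ->
  forall g, (forall x, g ^ x \in 'Gal({:E} / K))%g -> g = 1%g.
Proof.
case=> _ galE minE g Kg.
pose R := [group of gcore 'Gal({:E} / K) 'Gal({:E} / 1)].
have Rg : g \in R.
  by apply/bigcapP=> x _; rewrite mem_conjg.
have sKR : (K <= fixedField R)%VS.
  apply: subv_trans (galois_connection_subv (subvf K)) (fixedFieldS _).
  exact: gcore_sub.
have nsR : R <| 'Gal({:E} / 1).
  rewrite /normal gcore_norm andbT.
  exact: subset_trans (gcore_sub _ _) (galS _ (sub1v _)).
have galR : galois 1 (fixedField R) by apply: normal_fixedField_galois nsR.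
have /subvP sER := minE [aspace of fixedField R] sKR galR.
apply/eqP/gal_eqP=> a _; rewrite gal_id.
by have /fixedFieldP := sER a (memvf a); apply; rewrite ?memvf.
Qed.

(** * Intermediate fields of degree 12 and 24 *)

Unset Implicit Arguments.
Set Strict Implicit.
Set Printing Implicit Defensive.

(* Kt is the Galois closure of K/k; [F : k] is \dim F. *)
Theorem proposition4p8 (k : fieldType) (Kt : splittingFieldType k)
    (K : {subfield Kt})
    (dimK : \dim K = 6%N)
    (sepK : separable 1 K)
    (closK : is_galois_closure K {:Kt}%AS)
    (galK : perm_isomorphic
              (rcosets 'Gal({:Kt} / K) 'Gal({:Kt} / 1))
              (coset_perms 'Gal({:Kt} / 1)%G 'Gal({:Kt} / K)%G)
              group6T11) :
  (forall F : {subfield Kt},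
      (K <= F)%VS -> \dim F = 12%N -> ~ hopf_galois (subvs_of F))
  /\
  ((exists F : {subfield Kt},
      [/\ (K <= F)%VS, \dim F = 24%N & almost_classically_galois F])
   /\
   (forall C : {group gal_of {:Kt}%AS},
      C <| 'Gal({:Kt} / K) -> #|C| = 2%N ->
      forall F : {subfield Kt},
        (K <= F)%VS -> \dim F = 24%N -> F != fixedField C :> {vspace Kt} ->
        almost_classically_galois F /\
        exists S1 S2 : hopf_galois_structure (subvs_of F),
          ~ hgs_isomorphic S1 S2)).
Proof.
have [_ galE minE] := closK.
pose gT := gal_of {:Kt}; pose S := 'Gal({:Kt} / K)%G.
have galT (g : gT) : g \in 'Gal({:Kt} / 1)%G.
  by rewrite gal_kAut ?sub1v // kAutfE k1HomE; apply: valP (gal_repr g).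
have [N [c [r [t [z [u oct]]]]]] :=
  perm_isomorphic_octahedral galT (galois_closure_core closK) galK.
have galF (F : {subfield Kt}) : galois F {:Kt}.
  by apply: galoisS galE; rewrite sub1v subvf.
have cardT : #|[set: gT]| = 48%N := card_octahedral oct.
have dimE : \dim {:Kt} = 48%N.
  rewrite -cardT; have := galois_dim galE; rewrite dimv1 divn1 => ->.
  by apply: eq_card => g; rewrite galT inE.
have cardU (F : {subfield Kt}) : (#|'Gal({:Kt} / F)| * \dim F)%N = 48%N.
  by rewrite -(galois_dim (galF F)) -dim_sup_field ?subvf.
have cardS : #|S| = 8%N.
  by apply/eqP; rewrite -(eqn_pmul2r (isT : 0 < 6)%N) -{1}dimK cardU.
have sUS (F : {subfield Kt}) : (K <= F)%VS -> 'Gal({:Kt} / F) \subset S.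
  exact: galS.
have nsN : N <| [set: gT].
  apply: index2_normal; rewrite ?subsetT // -divgS ?subsetT // cardT.
  by rewrite (oct_cardN oct).
(* If [c] commuted with [t], the relation [oct_dt] would read [c = c * c]. *)
have notcG : c \notin 'C([set: gT]).
  apply/negP=> /centP/(_ t (in_setT _))/commgP/conjg_fixP ct.
  have /eqP := oct_dt oct; rewrite ct ct -{1}[c]mulg1 (inj_eq (mulgI c)) eq_sym.
  by rewrite (negPf (oct_c1 oct)).
split=> [F sKF dimF [HF] | ].
  have cardU4 : #|'Gal({:Kt} / F)| = 4%N.
    by apply/eqP; rewrite -(eqn_pmul2r (isT : 0 < 12)%N) -{1}dimF cardU.
  have nsUS : 'Gal({:Kt} / F) <| S.
    by apply: index2_normal; rewrite ?sUS // -divgS ?sUS // cardS cardU4.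
  (* The group of [F] has index 2 in [S], so it contains the square [c] of [r]. *)
  have Uc : c \in 'Gal({:Kt} / F).
    rewrite -(oct_r2 oct); have Sr := oct_r oct.
    have nUr := subsetP (normal_norm nsUS) r Sr.
    apply: coset_idr; first exact: groupX.
    rewrite morphX //.
    have -> : 2%N = #|(S / 'Gal({:Kt} / F))%g|.
      by rewrite card_quotient ?normal_norm // -divgS ?sUS // cardS cardU4.
    by apply: expg_cardG; apply: mem_quotient.
  have [M [transM semiM nMl]] := hopf_galois_regular HF.
  apply: (no_regular_on_cosets (c := c) (t := t) (z := z) cardT cardU4 Uc _ _ _ _
    _ _ _ _ _ _ transM semiM nMl).
  - exact: subsetP (centS (sUS F sKF)) c (oct_cSc oct).
  - exact: oct_cardC oct.
  - by move=> g Ucg; apply: (oct_conj oct); apply: subsetP (sUS F sKF) _ Ucg.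
  - exact: oct_c2 oct.
  - exact: oct_ccd oct.
  - exact: oct_dt oct.
  - exact: oct_z2 oct.
  - by apply: contra (oct_Sz oct); apply: subsetP (sUS F sKF) z.
  - exact: oct_czc oct.
  - exact: oct_czt oct.
(* The group of [F] has order 2, and [c] is the only involution of [S] in [N]. Without [c] it meets
   [N] trivially, and 24 times 2 is 48. *)
have sdNU (F : {subfield Kt}) : (K <= F)%VS -> \dim F = 24%N ->
    c \notin 'Gal({:Kt} / F) -> (N ><| 'Gal({:Kt} / F)%G)%g = [set: gT].
  move=> sKF dimF notUc.
  have cardU2 : #|'Gal({:Kt} / F)| = 2%N.
    by apply/eqP; rewrite -(eqn_pmul2r (isT : 0 < 24)%N) -{1}dimF cardU.
  have tiNU : N :&: 'Gal({:Kt} / F) = 1%g.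
    apply/trivgP/subsetP=> x /setIP[Nx Ux]; rewrite inE.
    have x2 : (x ^+ 2 = 1)%g by rewrite -cardU2 expg_cardG.
    have [-> // | xc] := oct_Ninv oct (subsetP (sUS F sKF) x Ux) Nx x2.
    by rewrite xc (negPf notUc) in Ux.
  rewrite sdprodE //; last exact: subset_trans (subsetT _) (normal_norm nsN).
  apply/eqP; rewrite eqEcard subsetT TI_cardMg // cardT.
  by rewrite (oct_cardN oct) cardU2.
have acg (F : {subfield Kt}) : (K <= F)%VS -> \dim F = 24%N ->
    c \notin 'Gal({:Kt} / F) -> almost_classically_galois F.
  move=> sKF dimF notUc; split.
    by apply: separableS (subvf F) _; case/and3P: galE.
  exists {:Kt}%AS.
    split=> // [|M sFM galM]; first exact: subvf.
    by apply: minE galM; apply: subv_trans sFM.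
  have sdG : (N ><| 'Gal({:Kt} / F)%G)%g = 'Gal({:Kt} / 1)%G.
    by rewrite sdNU //; apply/setP=> g; rewrite galT inE.
  exact: complement_translations sdG.
have defF (F : {subfield Kt}) : fixedField 'Gal({:Kt} / F) = F.
  exact: galois_fixedField (galF F).
split=> [|C nsCS cardC F sKF dimF neFC].
  (* The fixed field of an involution of [S] other than [c] serves as witness. *)
  have [Su u2 u1 uc] := oct_u oct.
  have ou : #[u]%g = 2%N by apply: nt_prime_order => //; apply/eqP.
  pose Fu : {subfield Kt} := [aspace of fixedField <[u]>%g].
  have galFu : 'Gal({:Kt} / Fu) = <[u]>%g by exact: gal_fixedField.
  exists Fu; have sKF : (K <= Fu)%VS.
    by rewrite -{1}(defF K); apply: fixedFieldS; rewrite cycle_subG.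
  have dimF : \dim Fu = 24%N.
    apply/eqP; rewrite -(eqn_pmul2l (isT : 0 < 2)%N).
    by have := cardU Fu; rewrite galFu -orderE ou => ->.
  split=> //; apply: acg => //.
  rewrite galFu (cycle2g ou) !inE negb_or (oct_c1 oct) /=.
  by apply/eqP=> cu; case: uc.
have [x Cx x1] : exists2 x, x \in C & x != 1%g.
  by apply/trivgPn; rewrite -cardG_gt1 cardC.
have order2 (A : {group gT}) y :
    #|A| = 2%N -> y \in A -> y != 1%g -> A :=: <[y]>%g.
  move=> cardA Ay y1; apply/eqP; rewrite eq_sym eqEcard cycle_subG Ay cardA.
  by rewrite -orderE order_gt1.
have Sx : x \in S := subsetP (normal_sub nsCS) x Cx.
(* A normal subgroup of order 2 is central, so [C] is generated by [c]. *)
have cSx : x \in 'C(S)%g.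
  apply/centP=> s Ss; apply/commgP/conjg_fixP.
  have : (x ^ s)%g \in C by rewrite memJ_norm // (subsetP (normal_norm nsCS)).
  have defC := order2 C x cardC Cx x1.
  have ox : #[x]%g = 2%N by rewrite orderE -defC.
  rewrite {1}defC (cycle2g ox) !inE.
  by rewrite -(conj1g s) (inj_eq (conjg_inj s)) (negPf x1) => /eqP.
have Cc : c \in C.
  by have [x1' | <- //] := oct_center oct Sx cSx; rewrite x1' eqxx in x1.
(* A group of order 2 containing [c] is [C], which would make [F] its fixed field. *)
have notUc : c \notin 'Gal({:Kt} / F).
  apply: contra neFC => Uc.
  have cardU2 : #|'Gal({:Kt} / F)| = 2%N.
    by apply/eqP; rewrite -(eqn_pmul2r (isT : 0 < 24)%N) -{1}dimF cardU.
  rewrite -{1}(defF F) (order2 _ c cardU2 Uc (oct_c1 oct)).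
  by rewrite -(order2 C c cardC Cc (oct_c1 oct)).
split; first exact: acg.
have cUc : c \in 'C('Gal({:Kt} / F)%G).
  exact: subsetP (centS (sUS F sKF)) c (oct_cSc oct).
exists (conj_structure galE (sdNU F sKF dimF notUc)),
  (twisted_structure galE (sdNU F sKF dimF notUc)).
exact: normal_complement_structures (oct_Nc oct) cUc notcG.
Qed.
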